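(* Let $\beta$ be a fixed non-negative integer. The problem \textsc{pLS-Vertex Cover} restricted to $\beta$-separable graphs is fixed-parameter tractable: there is an algorithm solving it in time $2^q q^{O(\log q)} n^{O(1)}$, where $q=k+\beta k$ and $n$ is the number of vertices of the input graph.
   Context: All graphs are finite, undirected and simple. A vertex cover of $G=(V,E)$ is a set $S\subseteq V$ meeting every edge. For sets $S_1,S_2$, $\mathrm{dist}(S_1,S_2)=|S_1\cup S_2|-|S_1\cap S_2|$. \textsc{pLS-Vertex Cover} (permissive local search for vertex cover): the input is a graph $G$, a vertex cover $S$ of $G$, and a positive integer $k$ (the parameter); the task is either to determine that $G$ has no vertex cover $S'$ with $\mathrm{dist}(S,S')\le k$ and $|S'|<|S|$, or to find a vertex cover $S''$ of $G$ with $|S''|<|S|$ (not necessarily within distance $k$ of $S$). For a fixed non-negative integer $\beta$, a graph $G=(V,E)$ is $\beta$-separable if $V$ can be partitioned into $V_1$ and $V_2$ such that every $v\in V_1$ satisfies $|N(v)\cap V_1|\le\beta$ and every $w\in V_2$ satisfies $|N(w)|\le\beta$. *)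

(* Defs.v *)
From mathcomp Require Import all_boot.

Set Implicit Arguments.
Unset Strict Implicit.
Unset Printing Implicit Defensive.

(* Model of computation: first-order call-by-value programs over binary trees
   (pure LISP).  The running time counts one unit per evaluated subexpression.
   For a fixed program every rule below is O(1) work on a pointer machine or a
   word RAM (trees are shared, environments have length bounded by the program
   text), and a RAM is simulated with a logarithmic overhead, memory being kept
   in a balanced tree.  Bounds of the form 2^q q^O(log q) n^O(1) are therefore
   the same in this model and on a RAM. *)

Inductive tree := Leaf | Node of tree & tree.

Inductive expr :=
| Var of nat                    (* de Bruijn index in the environment *)
| Lf
| Nd of expr & expr
| Let of expr & expr
| Case of expr & expr & expr    (* the Node branch binds the left subtree as
                                   variable 0 and the right one as variable 1 *)
| Call of nat & expr.           (* call of the i-th function of the program *)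

(* The bodies of mutually recursive unary functions; variable 0 is the argument
   and function 0 is the entry point. *)
Definition program := seq expr.

Inductive eval (p : program) : seq tree -> expr -> tree -> nat -> Prop :=
| EvVar s i : eval p s (Var i) (nth Leaf s i) 1
| EvLf s : eval p s Lf Leaf 1
| EvNd s a b u v t1 t2 :
    eval p s a u t1 -> eval p s b v t2 ->
    eval p s (Nd a b) (Node u v) (t1 + t2).+1
| EvLet s a b u v t1 t2 :
    eval p s a u t1 -> eval p (u :: s) b v t2 ->
    eval p s (Let a b) v (t1 + t2).+1
| EvCaseLf s a b c v t1 t2 :
    eval p s a Leaf t1 -> eval p s b v t2 ->
    eval p s (Case a b c) v (t1 + t2).+1
| EvCaseNd s a b c x y v t1 t2 :
    eval p s a (Node x y) t1 -> eval p [:: x, y & s] c v t2 ->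
    eval p s (Case a b c) v (t1 + t2).+1
| EvCall s i a u v t1 t2 :
    eval p s a u t1 -> eval p [:: u] (nth Lf p i) v t2 ->
    eval p s (Call i a) v (t1 + t2).+1.

Definition runs (p : program) (input output : tree) (time : nat) : Prop :=
  eval p [:: input] (nth Lf p 0) output time.

Lemma eval_det p s e v1 t1 v2 t2 :
  eval p s e v1 t1 -> eval p s e v2 t2 -> v1 = v2 /\ t1 = t2.
Proof.
move=> H; elim: H v2 t2 => {s e v1 t1}.
- by move=> s i v t E; inversion E.
- by move=> s v t E; inversion E.
- move=> s a b u v t1 t2 _ IH1 _ IH2 w t E.
  inversion E as [| |? ? ? ? ? ? ? E1 E2| | | |]; subst.
  by have [-> ->] := IH1 _ _ E1; have [-> ->] := IH2 _ _ E2.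
- move=> s a b u v t1 t2 _ IH1 _ IH2 w t E.
  inversion E as [| | |? ? ? ? ? ? ? E1 E2| | |]; subst.
  have [eu ->] := IH1 _ _ E1; rewrite -eu in E2.
  by have [-> ->] := IH2 _ _ E2.
- move=> s a b c v t1 t2 _ IH1 _ IH2 w t E.
  inversion E as [| | | |? ? ? ? ? ? ? E1 E2|? ? ? ? ? ? ? ? ? E1 E2|]; subst.
    by have [_ ->] := IH1 _ _ E1; have [-> ->] := IH2 _ _ E2.
  by have [] := IH1 _ _ E1.
- move=> s a b c x y v t1 t2 _ IH1 _ IH2 w t E.
  inversion E as [| | | |? ? ? ? ? ? ? E1 E2|? ? ? ? ? ? ? ? ? E1 E2|]; subst.
    by have [] := IH1 _ _ E1.
  have [[ex ey] ->] := IH1 _ _ E1; rewrite -ex -ey in E2.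
  by have [-> ->] := IH2 _ _ E2.
- move=> s i a u v t1 t2 _ IH1 _ IH2 w t E.
  inversion E as [| | | | | |? ? ? ? ? ? ? E1 E2]; subst.
  have [eu ->] := IH1 _ _ E1; rewrite -eu in E2.
  by have [-> ->] := IH2 _ _ E2.
Qed.

Fixpoint tree_size (u : tree) : nat :=
  if u is Node a b then (tree_size a + tree_size b).+1 else 1.

Definition list_tree : seq tree -> tree := foldr Node Leaf.

Definition bool_tree (b : bool) : tree := if b then Node Leaf Leaf else Leaf.

(* Unary; time bounds below are at least 2^k, so that converting between the
   unary and the binary notation of the parameter k is negligible. *)
Definition nat_tree (m : nat) : tree := list_tree (nseq m Leaf).

Definition computable (f : nat -> nat) : Prop :=
  exists p : program, forall m, exists t, runs p (nat_tree m) (nat_tree (f m)) t.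

(* A parameterized search problem: [answer x v] says that the output [v] is
   correct for the instance [x].  Inputs satisfying [valid] are the ones the
   problem is posed on. *)
Record param_problem := ParamProblem {
  instance : Type;
  valid : instance -> Prop;
  encode : instance -> tree;
  parameter : instance -> nat;
  answer : instance -> tree -> Prop
}.

Definition solvable_in_time (P : param_problem) (T : instance P -> nat) : Prop :=
  exists p : program, forall x : instance P, valid x ->
    exists (v : tree) (t : nat),
      [/\ runs p (encode x) v t, answer x v & t <= T x].

Definition fixed_parameter_tractable (P : param_problem) : Prop :=
  exists (f : nat -> nat) (c : nat), computable f /\
    @solvable_in_time P
      (fun x => f (parameter x) * tree_size (encode x) ^ c).

Record sgraph (V : finType) := SGraph {
  adj :> rel V;
  adj_sym : symmetric adj;
  adj_irrefl : irreflexive adj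
}.

Definition neighbors (V : finType) (G : sgraph V) (v : V) : {set V} := [set w | G v w].

Definition vertex_cover (V : finType) (G : sgraph V) (S : {set V}) : Prop :=
  forall u v, G u v -> (u \in S) || (v \in S).

Definition dist (V : finType) (S1 S2 : {set V}) : nat := #|S1 :|: S2| - #|S1 :&: S2|.

Definition separable (V : finType) (G : sgraph V) (beta : nat) : Prop :=
  exists V1 V2 : {set V},
    [/\ V1 :|: V2 = [set: V], [disjoint V1 & V2],
        (forall v, v \in V1 -> #|neighbors G v :&: V1| <= beta) &
        (forall w, w \in V2 -> #|neighbors G w| <= beta)].

Record pls_vc_instance := PlsVcInstance {
  nverts : nat;
  graph : sgraph 'I_nverts;
  cover : {set 'I_nverts};
  radius : nat
}.

Definition set_tree n (S : {set 'I_n}) : tree :=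
  list_tree [seq bool_tree (i \in S) | i <- enum 'I_n].

(* Adjacency matrix, row by row. *)
Definition graph_tree n (G : sgraph 'I_n) : tree :=
  list_tree [seq set_tree (neighbors G i) | i <- enum 'I_n].

Definition pls_vc_encode (x : pls_vc_instance) : tree :=
  list_tree [:: graph_tree (graph x); set_tree (cover x); nat_tree (radius x)].

(* The output [Leaf] claims that no smaller vertex cover is within the given
   distance; the output [Node Leaf w] presents the set encoded by [w]. *)
Definition pls_vc_answer (x : pls_vc_instance) (v : tree) : Prop :=
  (v = Leaf /\
   ~ exists S' : {set 'I_(nverts x)},
       [/\ vertex_cover (graph x) S', dist (cover x) S' <= radius x
         & #|S'| < #|cover x|])
  \/
  (exists S'' : {set 'I_(nverts x)},
     [/\ v = Node Leaf (set_tree S''), vertex_cover (graph x) S''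
       & #|S''| < #|cover x|]).

Definition pls_vc (beta : nat) : param_problem := {|
  instance := pls_vc_instance;
  valid := fun x => [/\ vertex_cover (graph x) (cover x), 0 < radius x
                      & separable (graph x) beta];
  encode := pls_vc_encode;
  parameter := radius;
  answer := pls_vc_answer
|}.

(* 2^q q^O(log q) n^O(1), with one constant [c] for all the hidden ones.  The
   base is [n.+1] so that the bound does not vanish on the empty graph; for
   n > 0 it differs from n^O(1) by a constant factor only.  The binary logarithm
   is rounded down, which for q > 1 changes it by a factor less than 2. *)
Definition time_bound (c q n : nat) : nat :=
  c * (2 ^ q * q ^ (c * trunc_log 2 q) * n.+1 ^ c).

(* Main.v *)
(** Let [S] be a vertex cover.  A smaller cover at distance at most [k] exists
    only if some independent [A] inside [S] with at most [(k+1)/2] elements has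
    fewer than [#|A|] neighbours outside [S]; and any independent [A] with fewer
    than [#|A|] neighbours outside [S] gives a smaller cover.

    The low-degree vertices of the partition may be taken to be all vertices of
    degree at most [beta].  Colour the vertices, keep the green vertices of [S],
    and delete a kept vertex of low degree with a kept neighbour and a kept vertex
    of high degree with a kept neighbour of high degree.  The survivors are
    independent, and [A] survives if [A] is green and at most [beta * #|A|]
    further vertices are not.  Among independent survivors the smaller cover comes
    from a violation of Hall's condition, found in polynomial time by an auction.

    The colourings are all sequences produced by binary linear recurrences of
    order [m], with [2 ^ m > n * 2 ^ s] for the number [s <= (1+beta)(k+1)/2] of
    vertices whose colour matters.  In the field with [2 ^ m] elements fewer than
    [n * 2 ^ s] points [x] make the [s] relevant powers of [x] linearly dependent
    over F_2; for any other [x] a linear form takes prescribed values on these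
    powers, and [t |-> phi (x ^ t)] is such a sequence.  There are [4 ^ m]
    sequences, that is [2 ^ q n^O(1)]. *)

Require Import Defs.
From mathcomp Require Import all_boot all_algebra all_field zify.

Set Implicit Arguments.
Unset Strict Implicit.
Unset Printing Implicit Defensive.

(** * Evaluation within a time bound *)

Definition ev (p : program) (s : seq tree) (e : expr) (v : tree) (T : nat) : Prop :=
  exists2 t, eval p s e v t & t <= T.

Section EvRules.
Variable p : program.
Implicit Types (s : seq tree) (e a b c : expr) (u v w x y : tree) (T : nat).

Lemma ev_le s e v T T' : ev p s e v T -> T <= T' -> ev p s e v T'.
Proof. by move=> [t h le_tT] le_TT'; exists t => //; apply: leq_trans le_TT'. Qed.

Lemma ev_var s i v : nth Leaf s i = v -> ev p s (Var i) v 1.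
Proof. by move=> <-; exists 1 => //; constructor. Qed.

Lemma ev_lf s : ev p s Lf Leaf 1.
Proof. by exists 1 => //; constructor. Qed.

Lemma ev_nd s a b u v T1 T2 :
  ev p s a u T1 -> ev p s b v T2 -> ev p s (Nd a b) (Node u v) (T1 + T2).+1.
Proof.
by move=> [t1 h1 l1] [t2 h2 l2]; exists (t1 + t2).+1; [exact: EvNd|rewrite /=; lia].
Qed.

Lemma ev_let s a b u v T1 T2 :
  ev p s a u T1 -> ev p (u :: s) b v T2 -> ev p s (Let a b) v (T1 + T2).+1.
Proof.
by move=> [t1 h1 l1] [t2 h2 l2]; exists (t1 + t2).+1; [exact: EvLet h1 h2|rewrite /=; lia].
Qed.

Lemma ev_case_leaf s a b c v T1 T2 :
  ev p s a Leaf T1 -> ev p s b v T2 -> ev p s (Case a b c) v (T1 + T2).+1.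
Proof.
by move=> [t1 h1 l1] [t2 h2 l2]; exists (t1 + t2).+1; [exact: EvCaseLf|rewrite /=; lia].
Qed.

Lemma ev_case_node s a b c x y v T1 T2 :
  ev p s a (Node x y) T1 -> ev p [:: x, y & s] c v T2 ->
  ev p s (Case a b c) v (T1 + T2).+1.
Proof.
move=> [t1 h1 l1] [t2 h2 l2]; exists (t1 + t2).+1; [exact: EvCaseNd h1 h2|rewrite /=; lia].
Qed.

Lemma ev_case s a b c u v T1 T2 :
  ev p s a u T1 ->
  (if u is Node x y then ev p [:: x, y & s] c v T2 else ev p s b v T2) ->
  ev p s (Case a b c) v (T1 + T2).+1.
Proof. by case: u => [|x y] h1 h2; [apply: ev_case_leaf h1 h2|apply: ev_case_node h1 h2]. Qed.

Lemma ev_call s i a u v T1 T2 :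
  ev p s a u T1 -> ev p [:: u] (nth Lf p i) v T2 ->
  ev p s (Call i a) v (T1 + T2).+1.
Proof.
by move=> [t1 h1 l1] [t2 h2 l2]; exists (t1 + t2).+1; [exact: EvCall h1 h2|rewrite /=; lia].
Qed.

End EvRules.

(** * The algorithm on bit vectors *)

Definition bits (l : seq bool) : tree := list_tree (map bool_tree l).

(** When [b] runs out, the rest of [a] stays: missing bits of [b] count as [false], in agreement
    with the default of [nth]. *)
Fixpoint andn (a b : seq bool) : seq bool :=
  match a, b with
  | x :: a', y :: b' => (x && ~~ y) :: andn a' b'
  | _, _ => a
  end.
(** The intersection as a double difference, so that a single bitwise routine serves the whole
    program. *)
Definition meet (a b : seq bool) : nat := count id (andn a (andn a b)).

Lemma size_andn a b : size (andn a b) = size a.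
Proof. by elim: a b => [|x a IH] [|y b] //=; rewrite IH. Qed.

Lemma nth_andn a b i : nth false (andn a b) i = nth false a i && ~~ nth false b i.
Proof.
elim: a b i => [|x a IH] [|y b] [|i] //=; rewrite ?nth_nil ?andbT //.
Qed.

(** The inner product over F_2, that is, the feedback of a linear shift register with taps [f]. *)
Definition dot (f w : seq bool) : bool := odd (meet f w).
(* The most recent bit comes first, so [w] is the reversed initial segment. *)
Fixpoint gen (n : nat) (w f : seq bool) : seq bool :=
  if n is n'.+1 then gen n' (dot f w :: w) f else w.

(* [x] and [y] say whether the vertex is green and of low degree; [g] and [g1] are the
   green vertices and the green vertices of high degree. *)
Definition entry (g g1 S row : seq bool) (x y : bool) : option (seq bool) :=
  if x && (meet row (if y then g else g1) == 0) then Some (andn row S) else None.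
Definition buildq (g g1 S : seq bool) (rows : seq (seq bool)) (xs ys : seq bool) :=
  [seq entry g g1 S t.1 t.2.1 t.2.2 | t <- zip rows (zip xs ys)].

(* A level and the row of the bidder that owns the cell. *)
Notation cell := (nat * option (seq bool))%type.
Fixpoint max_level (a : seq bool) (st : seq cell) (best : nat) : nat :=
  match a, st with
  | x :: a', c :: st' => max_level a' st' (if x && (best < c.1) then c.1 else best)
  | _, _ => best
  end.
(** The first component returned is the evicted owner, who has to bid again. *)
Fixpoint place_bid (a : seq bool) (st : seq cell) (p : nat) (new : option (seq bool)) :
    option (seq bool) * seq cell :=
  match a, st with
  | x :: a', c :: st' =>
      if x && (p <= c.1) then (c.2, (c.1.-1, new) :: st')
      else let r := place_bid a' st' p new in (r.1, c :: r.2)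
  | _, _ => (None, st)
  end.
Fixpoint bidding (fuel : nat) (W : seq (option (seq bool))) (st : seq cell) : seq cell :=
  if fuel is fuel'.+1 then
    match W with
    | [::] => st
    | None :: W' => bidding fuel' W' st
    | Some a :: W' =>
        let p := max_level a st 0 in
        if p == 0 then bidding fuel' W' st
        else let r := place_bid a st p (Some a) in bidding fuel' (r.1 :: W') r.2
    end
  else st.
(** The potential of the auction: a bid lowers it by one. *)
Definition load (st : seq cell) : nat := sumn (map fst st).

(** The candidates for the neighbourhood of a Hall violator are the level sets of the final
    state. *)
Definition below (st : seq cell) (i : nat) : seq bool := [seq c.1 < i | c <- st].
(** The exchange: bidders whose row lies inside [B] leave [S], and [B] enters. *)
Definition newbit (B : seq bool) (x : bool) (q : option (seq bool)) (y : bool) : bool :=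
  if x then (if q is Some row then count id (andn row B) != 0 else true) else y.
Definition newset (B S : seq bool) (Q : seq (option (seq bool))) (ys : seq bool) :=
  [seq newbit B t.1 t.2.1 t.2.2 | t <- zip S (zip Q ys)].
Fixpoint try_levels (i : nat) (S : seq bool) (Q : seq (option (seq bool))) (st : seq cell) :=
  if i is i'.+1 then
    let B := below st i in
    let T := newset B S Q B in
    if count id T < count id S then Some T else try_levels i' S Q st
  else None.

Definition lg (n : nat) : nat := if n == 0 then 0 else (trunc_log 2 n).+1.

(** This is also the output format of the problem, so the result of the search is returned as it
    stands. *)
Definition enc_entry (o : option (seq bool)) : tree :=
  if o is Some row then Node Leaf (bits row) else Leaf.
Definition enc_cell (c : cell) : tree := Node (nat_tree c.1) (enc_entry c.2).
Definition enc_st (st : seq cell) : tree := list_tree (map enc_cell st).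
Definition ok_enc_entry (M : nat) (o : option (seq bool)) : bool :=
  if o is Some row then size row <= M else true.
Definition ok_cell (M : nat) (c : cell) : bool := (c.1 <= M) && ok_enc_entry M c.2.

(** * Effect of a single bid on levels, load and sizes *)

Lemma place_bid_cases a st p new (c0 : cell) (r := place_bid a st p new) :
  (exists u, [/\ u < size st, nth false a u, p <= (nth c0 st u).1,
      r.1 = (nth c0 st u).2 & r.2 = set_nth c0 st u ((nth c0 st u).1.-1, new)])
  \/ ((forall u, u < size st -> nth false a u -> (nth c0 st u).1 < p) /\ r = (None, st)).
Proof.
rewrite {}/r; elim: a st => [|x a IH] [|c st] /=.
- by right; split => // u; rewrite nth_nil.
- by right; split => // u; rewrite nth_nil.
- by right.
case: ifP => [/andP[-> le_p]|Ex]; first by left; exists 0; rewrite /= le_p.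
have [[u [lt_u au le_p e1 e2]]|[lt_p ->]] := IH st.
  by left; exists u.+1; rewrite /= e1 e2 au.
right; split=> // -[|u] //= lt_u au; last exact: lt_p.
by move: Ex; rewrite au /=; lia.
Qed.

Lemma max_level_ge a st b (c0 : cell) u :
  u < size st -> nth false a u -> (nth c0 st u).1 <= max_level a st b.
Proof.
have ge_b a' st' b' : b' <= max_level a' st' b'.
  elim: a' st' b' => [|x a' IH] [|c st'] b' //=.
  by apply: leq_trans (IH _ _); case: ifP => // /andP[_ /ltnW].
elim: a st b u => [|x a IH] [|c st] b [|u] //=.
- by move=> _ ->; apply: leq_trans (ge_b _ _ _) => /=; case: ifP; lia.
- by move=> lt_u au; apply: IH.
Qed.

Lemma max_level_cases a st b (c0 : cell) :
  max_level a st b = b \/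
  exists u, [/\ u < size st, nth false a u & (nth c0 st u).1 = max_level a st b].
Proof.
elim: a st b => [|x a IH] [|c st] b /=; try by left.
have [e|[u [lt_u au e]]] := IH st (if x && (b < c.1) then c.1 else b).
  rewrite e; case: ifP => [/andP[-> _]|_]; last by left.
  by right; exists 0.
by right; exists u.+1.
Qed.

(** The level [p] is attained on [a], so the bid is placed, and it is placed where the level is
    positive and really drops. *)
Lemma load_place_bid a st p new : 0 < p -> p = max_level a st 0 ->
  load (place_bid a st p new).2 < load st.
Proof.
move=> p_gt0 ep; have [[u [lt_u _ le_p _ ->]]|[lt_p _]] := place_bid_cases a st p new (0, None).
  rewrite /load; elim: st u lt_u le_p {ep} => [|c st IH] [|u] //= lt_u le_p.
    by rewrite ltn_add2r; lia.
  by rewrite ltn_add2l; apply: IH.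
have [e|[u [lt_u au e]]] := max_level_cases a st 0 (0, None); first by lia.
by have := lt_p u lt_u au; rewrite e -ep ltnn.
Qed.

Lemma ok_place_bid M a st p new : ok_enc_entry M new -> all (ok_cell M) st ->
  ok_enc_entry M (place_bid a st p new).1 && all (ok_cell M) (place_bid a st p new).2.
Proof.
move=> ok_new; elim: a st => [|x a IH] [|c st] //= /andP[okc okst].
case: ifP => [_|_] /=.
  case/andP: okc => okc1 ->; rewrite /= okst /ok_cell /= ok_new !andbT; lia.
by have /andP[-> ->] := IH st okst; rewrite okc.
Qed.

Lemma size_place_bid a st p new : size (place_bid a st p new).2 = size st.
Proof. by elim: a st => [|x a IH] [|c st] //=; case: ifP => //= _; rewrite IH. Qed.

Lemma size_bidding fuel W st : size (bidding fuel W st) = size st.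
Proof.
by elim: fuel W st => [|fuel IH] [|[a|] W] st //=; case: ifP; rewrite IH ?size_place_bid.
Qed.

Lemma ok_bidding M fuel W st : all (ok_enc_entry M) W -> all (ok_cell M) st ->
  all (ok_cell M) (bidding fuel W st).
Proof.
elim: fuel W st => [|fuel IH] [|[a|] W] st //=; last exact: IH.
move=> /andP[ok_a ok_W] ok_st; case: ifP => _; first exact: IH.
have /andP[ok1 ok2] := @ok_place_bid M a st (max_level a st 0) (Some a) ok_a ok_st.
by apply: IH => //=; rewrite ok1.
Qed.

Section Algorithm.
Variables (beta : nat) (rows : seq (seq bool)) (S : seq bool).

Definition low : seq bool := [seq count id r < beta.+1 | r <- rows].
(** A generated 1 discards a vertex. Only the first [size S] entries, the latest ones generated, are
    read. *)
Definition green (f w : seq bool) : seq bool := andn S (gen (size S) w f).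
Definition queue (g : seq bool) := buildq g (andn g low) S rows g low.
(** One level more than there are cells: some positive level will be vacant, and unowned cells stay
    outside every level set that matters. *)
Definition init_st : seq cell := nseq (size S) ((size S).+1, None).
(** Every round shortens the queue or lowers the load, which gives the fuel. *)
Definition auction (Q : seq (option (seq bool))) : seq cell :=
  bidding (size Q + load init_st).+1 Q init_st.
Definition test (f w : seq bool) : option (seq bool) :=
  let Q := queue (green f w) in try_levels (size S).+1 S Q (auction Q).

Definition orelse (T : Type) (a b : option T) : option T := if a is Some _ then a else b.
Fixpoint search (m : nat) (f w : seq bool) : option (seq bool) :=
  if m is m'.+1 then
    orelse (search m' (false :: f) (false :: w)) (orelse (search m' (false :: f) (true :: w))
      (orelse (search m' (true :: f) (false :: w)) (search m' (true :: f) (true :: w))))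
  else test f w.
End Algorithm.

(** * The program *)

Section Program.
Variable beta : nat.

Definition tt_expr : expr := Nd Lf Lf.
(* [argsN e] destructures the argument, a right-nested tuple, and runs [e].  The last
   two components are variables 0 and 1, the one before them is variable 2, and
   every earlier one is two further up. *)
Definition args2 (e : expr) : expr := Case (Var 0) Lf e.
Definition args3 (e : expr) : expr := args2 (Case (Var 1) Lf e).
Definition args4 (e : expr) : expr := args3 (Case (Var 1) Lf e).
Definition args6 (e : expr) : expr := args4 (Case (Var 1) Lf (Case (Var 1) Lf e)).
Definition pack3 (a b c : expr) : expr := Nd a (Nd b c).
Definition pack4 (a b c d : expr) : expr := Nd a (pack3 b c d).
Definition or_else (a b : expr) : expr := Case a b (Nd (Var 0) (Var 1)).
Definition add_expr (m : nat) (e : expr) : expr := iter m (Nd Lf) e.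

(* Positions in [prog]. *)
Notation MAIN := 0. Notation ENUM := 1. Notation TEST := 2. Notation GEN := 3.
Notation PAR := 4. Notation UNA := 5. Notation CNT := 6. Notation ANDN := 7.
Notation MEET := 8. Notation LT := 9. Notation DEGS := 10.
Notation BUILDQ := 11. Notation ENTRY := 12. Notation INIT := 13.
Notation MAXE := 14. Notation UPD := 15. Notation LOOP := 16.
Notation BSET := 17. Notation NEWSET := 18. Notation NEWBIT := 19.
Notation TRY := 20. Notation HALF := 21. Notation LG := 22. Notation MK := 23.

(** The instance is a list of three items, whose terminating [Leaf] acts as a fourth component. *)
Definition main_body : expr := args4
  (Call ENUM (pack4 (Call MK (Nd (Var 0) (Call LG (Var 2)))) Lf Lf
                    (Nd (Var 4) (Var 2)))).
Definition enum_body : expr := args4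
  (let next b c :=
     Call ENUM (pack4 (Var 1) (Nd b (Var 4)) (Nd c (Var 2)) (Var 3)) in
   Case (Var 4) (Call TEST (pack3 (Var 2) (Var 0) (Var 1)))
     (or_else (next Lf Lf) (or_else (next Lf tt_expr)
       (or_else (next tt_expr Lf) (next tt_expr tt_expr))))).
Definition test_body : expr := args4
  (Let (Call ANDN (Nd (Var 1) (Call GEN (pack3 (Var 1) (Var 2) (Var 4)))))
  (Let (Call DEGS (Var 1))
  (Let (Call BUILDQ (pack4 (Var 2) (Var 1) (Var 0)
          (pack3 (Var 1) (Call ANDN (Nd (Var 1) (Var 0))) (Var 3))))
  (Let (Nd Lf (Call UNA (Var 4)))
  (Call TRY (pack4 (Var 0) (Var 5) (Var 1)
     (Call LOOP (Nd (Var 1) (Call INIT (Nd (Var 5) (Var 0))))))))))).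
Definition gen_body : expr := args3
  (Case (Var 2) (Var 0)
    (Call GEN (pack3 (Var 1)
       (Nd (Call PAR (Call MEET (Nd (Var 3) (Var 2)))) (Var 2)) (Var 3)))).
Definition par_body : expr :=
  Case (Var 0) Lf (Case (Call PAR (Var 1)) tt_expr Lf).
Definition una_body : expr := Case (Var 0) Lf (Nd Lf (Call UNA (Var 1))).
Definition cnt_body : expr :=
  Case (Var 0) Lf (Case (Var 0) (Call CNT (Var 1)) (Nd Lf (Call CNT (Var 3)))).
Definition andn_body : expr := args2
  (Case (Var 0) Lf (Case (Var 3) (Var 2)
     (Nd (Case (Var 0) (Var 2) Lf) (Call ANDN (Nd (Var 3) (Var 1)))))).
Definition meet_body : expr := args2
  (Call CNT (Call ANDN (Nd (Var 0) (Call ANDN (Nd (Var 0) (Var 1)))))).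
Definition lt_body : expr := args2
  (Case (Var 1) Lf (Case (Var 2) tt_expr (Call LT (Nd (Var 1) (Var 3))))).
Definition degs_body : expr :=
  Case (Var 0) Lf
    (Nd (Call LT (Nd (Call CNT (Var 0)) (add_expr beta.+1 Lf)))
        (Call DEGS (Var 1))).
Definition buildq_body : expr := args4
  (Case (Var 4) Lf (Case (Var 4) Lf (Case (Var 4) Lf
    (Nd (Call ENTRY (pack4 (Var 2) (Var 0) (Var 4) (Var 7)))
        (Call BUILDQ (pack4 (Var 5) (Var 3) (Var 1) (Var 7))))))).
Definition entry_body : expr := args6
  (Case (Var 8) Lf
    (Case (Call MEET (Nd (Var 6) (Case (Var 8) (Var 2) (Var 6))))
      (Nd Lf (Call ANDN (Nd (Var 6) (Var 3)))) Lf)).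
Definition init_body : expr := args2
  (Case (Var 0) Lf (Nd (Nd (Var 3) Lf) (Call INIT (Nd (Var 1) (Var 3))))).
Definition max_level_body : expr := args3
  (Case (Var 2) (Var 1) (Case (Var 2) (Var 3) (Case (Var 0) Lf
    (Case (Var 4) (Call MAXE (pack3 (Var 5) (Var 3) (Var 7)))
      (Call MAXE (pack3 (Var 7) (Var 5)
         (Case (Call LT (Nd (Var 9) (Var 2))) (Var 9) (Var 4)))))))).
(** [skip] is a macro for passing over a cell; [k] counts the additional variables bound in the
    branch that uses it. *)
Definition place_bid_body : expr := args4
  (let skip k :=
     Case (Call UPD (pack4 (Var (k + 5)) (Var (k + 3)) (Var (k + 6)) (Var (k + 7))))
       Lf (Nd (Var 0) (Nd (Var (k + 4)) (Var 1))) in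
   Case (Var 4) (Nd Lf (Var 2)) (Case (Var 4) tt_expr (Case (Var 0) Lf
    (Case (Var 4) (skip 0)
      (Case (Call LT (Nd (Var 2) (Var 8)))
        (Nd (Var 3) (Nd (Nd (Case (Var 2) Lf (Var 1)) (Var 9)) (Var 5)))
        (skip 4)))))).
Definition bidding_body : expr := args2
  (Case (Var 0) (Var 1) (Case (Var 0) (Call LOOP (Nd (Var 1) (Var 3)))
    (Let (Call MAXE (pack3 (Var 1) (Var 5) Lf))
      (Case (Var 0) (Call LOOP (Nd (Var 4) (Var 6)))
        (Case (Call UPD (pack4 (Var 4) (Var 8) (Var 2) (Var 5))) Lf
          (Call LOOP (Nd (Nd (Var 0) (Var 8)) (Var 1)))))))).
Definition below_body : expr := args2
  (Case (Var 0) Lf (Case (Var 0) Lf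
    (Nd (Call LT (Nd (Var 0) (Var 5))) (Call BSET (Nd (Var 3) (Var 5)))))).
Definition newset_body : expr := args4
  (Case (Var 4) Lf (Case (Var 4) Lf (Case (Var 4) Lf
    (Nd (Call NEWBIT (pack4 (Var 4) (Var 2) (Var 0) (Var 7)))
        (Call NEWSET (pack4 (Var 5) (Var 3) (Var 1) (Var 7))))))).
Definition newbit_body : expr := args4
  (Case (Var 4) (Var 0) (Case (Var 4) tt_expr
    (Case (Call CNT (Call ANDN (Nd (Var 1) (Var 5)))) Lf tt_expr))).
Definition try_body : expr := args4
  (Case (Var 4) Lf
    (Let (Call BSET (Nd (Var 3) (Var 6)))
    (Let (Call NEWSET (pack4 (Var 5) (Var 3) (Var 0) (Var 0)))
    (Case (Call LT (Nd (Call CNT (Var 0)) (Call CNT (Var 6))))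
      (Call TRY (pack4 (Var 3) (Var 6) (Var 4) (Var 5)))
      (Nd Lf (Var 2)))))).
Definition half_body : expr :=
  Case (Var 0) Lf (Case (Var 1) Lf (Nd Lf (Call HALF (Var 1)))).
Definition lg_body : expr := Case (Var 0) Lf (Nd Lf (Call LG (Call HALF (Var 2)))).
Definition mk_body : expr := args2
  (Case (Var 0) (Var 1)
    (Case (Var 1) (add_expr beta.+1 (Var 3))
      (add_expr beta.+1 (Call MK (Nd (Var 1) (Var 5)))))).

Definition prog : program :=
  [:: main_body; enum_body; test_body; gen_body; par_body; una_body; cnt_body;
      andn_body; meet_body; lt_body; degs_body; buildq_body; entry_body;
      init_body; max_level_body; place_bid_body; bidding_body; below_body; newset_body;
      newbit_body; try_body; half_body; lg_body; mk_body].

Definition fev (i : nat) (u v : tree) (T : nat) : Prop :=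
  ev prog [:: u] (nth Lf prog i) v T.

Lemma ev_fcall s i a u v T1 T2 :
  ev prog s a u T1 -> fev i u v T2 -> ev prog s (Call i a) v (T1 + T2).+1.
Proof. exact: ev_call. Qed.

Ltac body := rewrite /fev; cbn [nth prog]; apply: ev_le.
Ltac known := repeat match goal with
  | H : ?b = true |- context [?b] => rewrite H
  | H : ?b = false |- context [?b] => rewrite H
  | H : ?m = 0 |- context [?m] => rewrite H
  | H : ?m = _.+1 |- context [?m] => rewrite H end.
Ltac reduce_scrutinee :=
  lazymatch goal with
  | |- match ?u with Leaf => _ | Node x y => _ end =>
    let u' := eval hnf in u in change u with u'; cbv iota beta
  end.
(* Symbolic execution; the time bound is an evar that collects the cost of the path
   taken, and [calls] supplies the specification of a called function. *)
Ltac run calls :=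
  lazymatch goal with
  | |- ev _ _ (Var _) _ _ => eapply ev_var; cbn [nth]; reflexivity
  | |- ev _ _ Lf _ _ => apply ev_lf
  | |- ev _ _ (Nd _ _) _ _ => eapply ev_nd; [run calls|run calls]
  | |- ev _ _ (Let _ _) _ _ => eapply ev_let; [run calls|run calls]
  | |- ev _ _ (Case _ _ _) _ _ =>
      eapply ev_case; [run calls|known; reduce_scrutinee; run calls]
  | |- ev _ _ (Call _ _) _ _ => eapply ev_fcall; [run calls|calls]
  | |- ev _ _ ?e _ _ => let e' := eval hnf in e in progress change e with e'; run calls
  end.

(** * Running times of the list and arithmetic routines, with generous constants *)

Lemma fev_lt l1 l2 :
  fev LT (Node (list_tree l1) (list_tree l2)) (bool_tree (size l1 < size l2))
    (20 * (size l1).+1).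
Proof.
elim: l1 l2 => [|x l1 IH] [|y l2]; (body; [run ltac:(eapply IH)|rewrite /=; lia]).
Qed.

Lemma fev_par m : fev PAR (nat_tree m) (bool_tree (odd m)) (20 * m.+1).
Proof.
elim: m => [|m IH]; first by body; [run ltac:(fail)|].
by rewrite /=; case Em: (odd m) IH => IH; (body; [run ltac:(eapply IH)|rewrite /=; lia]).
Qed.

Lemma fev_una l : fev UNA (list_tree l) (nat_tree (size l)) (20 * (size l).+1).
Proof.
elim: l => [|x l IH]; (body; [run ltac:(eapply IH)|rewrite /=; lia]).
Qed.

Lemma fev_cnt l : fev CNT (bits l) (nat_tree (count id l)) (20 * (size l).+1).
Proof.
elim: l => [|[] l IH]; (body; [run ltac:(eapply IH)|rewrite /=; lia]).
Qed.

Lemma fev_andn a b : fev ANDN (Node (bits a) (bits b)) (bits (andn a b)) (20 * (size a).+1).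
Proof.
elim: a b => [|[] a IH] [|[] b]; (body; [run ltac:(eapply IH)|rewrite /=; lia]).
Qed.

Lemma fev_meet a b :
  fev MEET (Node (bits a) (bits b)) (nat_tree (meet a b)) (100 * (size a).+1).
Proof.
body; [run ltac:(first [eapply fev_andn|eapply fev_cnt])|rewrite size_andn; lia].
Qed.

Lemma meet_le a b : meet a b <= size a.
Proof. by apply: leq_trans (count_size _ _) _; rewrite size_andn. Qed.

(** [l] serves as a unary counter. A step costs time linear in [size f], however long the history
    [w] has become, because [meet f w] runs along [f]. *)
Lemma fev_gen l w f :
  fev GEN (Node (list_tree l) (Node (bits w) (bits f))) (bits (gen (size l) w f))
    ((size l).+1 * (200 * (size f).+1)).
Proof.
elim: l w => [|x l IH] w.
  by body; [run ltac:(fail)|rewrite /=; lia].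
body; [run ltac:(first [eapply (IH (_ :: _))|eapply fev_meet|eapply fev_par])|].
by have := meet_le f w; rewrite /=; lia.
Qed.

Lemma ev_add_expr s m e k T :
  ev prog s e (nat_tree k) T -> ev prog s (add_expr m e) (nat_tree (m + k)) (2 * m + T).
Proof.
move=> ek; elim: m => [|m IH] //=.
by apply: ev_le; [exact: ev_nd (ev_lf _ _) IH|rewrite /=; lia].
Qed.

Lemma fev_degs M rows : all (fun r => size r <= M) rows ->
  fev DEGS (list_tree (map bits rows)) (bits [seq count id r < beta.+1 | r <- rows])
    ((size rows).+1 * (100 * (M + beta).+1)).
Proof.
elim: rows => [|r rows IH] /=; first by move=> _; body; [run ltac:(fail)|rewrite /=; lia].
move=> /andP[le_r /IH {}IH]; body.
  eapply ev_case; [run idtac|].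
  reduce_scrutinee.
  eapply ev_nd; last by run ltac:(eapply IH).
  eapply ev_fcall; last first.
    have := fev_lt (nseq (count id r) Leaf) (nseq beta.+1 Leaf).
    by rewrite !size_nseq; apply.
  eapply ev_nd; first by run ltac:(eapply fev_cnt).
  have -> : list_tree (nseq beta.+1 Leaf) = nat_tree (beta.+1 + 0) by rewrite addn0.
  exact: (@ev_add_expr _ _ _ 0 _ (ev_lf _ _)).
by have := count_size id r; lia.
Qed.

Lemma fev_entry g g1 S row x y :
  fev ENTRY (Node (bool_tree x) (Node (bool_tree y) (Node (bits row)
              (Node (bits g) (Node (bits g1) (bits S))))))
    (enc_entry (entry g g1 S row x y)) (200 * (size row).+1).
Proof.
rewrite /entry; case: x; last by body; [run ltac:(fail)|rewrite /=; lia].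
by case: y => /=; case E: (meet _ _) => [|m];
  (body; [run ltac:(first [eapply fev_meet|eapply fev_andn])|rewrite /=; lia]).
Qed.

Lemma fev_buildq M g g1 S rows xs ys : all (fun r => size r <= M) rows ->
  fev BUILDQ (Node (list_tree (map bits rows)) (Node (bits xs) (Node (bits ys)
              (Node (bits g) (Node (bits g1) (bits S))))))
    (list_tree (map enc_entry (buildq g g1 S rows xs ys)))
    ((size rows).+1 * (300 * M.+1)).
Proof.
elim: rows xs ys => [|r rows IH] [|x xs] [|y ys] //= ok_rows;
  try by body; [run ltac:(fail)|rewrite /=; lia].
case/andP: ok_rows => le_r /IH{}IH.
by body; [run ltac:(first [eapply fev_entry|eapply IH])|rewrite /=; lia].
Qed.

(** * Running times of the auction and of the level sets *)

Lemma fev_init l N :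
  fev INIT (Node (list_tree l) (nat_tree N)) (enc_st (nseq (size l) (N, None)))
    (20 * (size l).+1).
Proof.
elim: l => [|x l IH]; (body; [run ltac:(eapply IH)|rewrite /=; lia]).
Qed.

Lemma fev_lt_nat m n : fev LT (Node (nat_tree m) (nat_tree n)) (bool_tree (m < n)) (20 * m.+1).
Proof. by have := fev_lt (nseq m Leaf) (nseq n Leaf); rewrite !size_nseq. Qed.

Lemma fev_max_level M a st best : best <= M -> all (ok_cell M) st ->
  fev MAXE (Node (bits a) (Node (enc_st st) (nat_tree best)))
    (nat_tree (max_level a st best)) ((size a).+1 * (60 * M.+1)).
Proof.
elim: a st best => [|x a IH] [|[e o] st] best le_best;
  try by move=> _; body; [run ltac:(fail)|rewrite /=; lia].
rewrite [all _ _]/= => /andP[/andP[/= le_e _] ok_st].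
case: x => /=; last by body; [run ltac:(eapply (IH _ _ le_best ok_st))|rewrite /=; lia].
case E: (best < e).
  by body; [run ltac:(first [eapply fev_lt_nat|eapply (IH _ _ le_e ok_st)])|rewrite /=; lia].
by body; [run ltac:(first [eapply fev_lt_nat|eapply (IH _ _ le_best ok_st)])|rewrite /=; lia].
Qed.

Lemma fev_place_bid M a st p new : all (ok_cell M) st ->
  fev UPD (Node (bits a) (Node (enc_st st) (Node (nat_tree p) (enc_entry new))))
    (Node (enc_entry (place_bid a st p new).1) (enc_st (place_bid a st p new).2))
    ((size a).+1 * (100 * M.+1)).
Proof.
elim: a st => [|x a IH] [|[e o] st];
  try by move=> _; body; [run ltac:(fail)|rewrite /=; lia].
rewrite [all _ _]/= => /andP[/andP[/= le_e _] ok_st].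
case: x => /=; last by body; [run ltac:(eapply (IH _ ok_st))|rewrite /=; lia].
case E: (e < p); rewrite leqNgt E /=.
  by body; [run ltac:(first [eapply fev_lt_nat|eapply (IH _ ok_st)])|rewrite /=; lia].
case: e E le_e => [|e] E le_e;
  by body; [run ltac:(first [eapply fev_lt_nat|eapply (IH _ ok_st)])|rewrite /=; lia].
Qed.

(** The program carries no fuel; the hypothesis ensures that the queue is empty before [fuel] is
    used up. A round passes along a row and compares unary levels, hence the square. *)
Lemma fev_bidding M fuel W st : all (ok_enc_entry M) W -> all (ok_cell M) st ->
  size W + load st < fuel ->
  fev LOOP (Node (list_tree (map enc_entry W)) (enc_st st)) (enc_st (bidding fuel W st))
    (fuel * (300 * M.+1 ^ 2)).
Proof.
elim: fuel W st => [|fuel IH] // [|[a|] W] st /=.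
- by move=> _ _ _; body; [run ltac:(fail)|rewrite expnS; lia].
- move=> /andP[ok_a ok_W] ok_st lt_fuel.
  have hmax := fev_max_level a (leq0n M) ok_st.
  have hupd := fev_place_bid a (max_level a st 0) (Some a) ok_st.
  have /andP[ok_kick ok_st'] := @ok_place_bid M a st (max_level a st 0) (Some a) ok_a ok_st.
  have load_lt : 0 < max_level a st 0 ->
      load (place_bid a st (max_level a st 0) (Some a)).2 < load st.
    by move=> p_gt0; apply: load_place_bid.
  have cost : (size a).+1 * (160 * M.+1) <= 160 * M.+1 ^ 2.
    by rewrite mulnCA leq_mul2l /= expnS expn1 leq_mul2r ltnS ok_a.
  case E: (max_level a st 0) => [|p] /=.
    have {}IH := IH W st ok_W ok_st ltac:(lia).
    by body; [run ltac:(first [eapply hmax|eapply IH])|rewrite /=; lia].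
  rewrite E in hmax hupd ok_kick ok_st' load_lt.
  have {}IH := IH ((place_bid a st p.+1 (Some a)).1 :: W) (place_bid a st p.+1 (Some a)).2
    ltac:(by rewrite /= ok_kick) ok_st'
    ltac:(have := load_lt isT; rewrite /=; lia).
  by body; [run ltac:(first [eapply hmax|eapply hupd|eapply IH])|rewrite /=; lia].
move=> ok_W ok_st lt_fuel; have {}IH := IH W st ok_W ok_st ltac:(lia).
by body; [run ltac:(eapply IH)|rewrite expnS; lia].
Qed.

Lemma fev_below M st i : all (ok_cell M) st ->
  fev BSET (Node (enc_st st) (nat_tree i)) (bits (below st i)) ((size st).+1 * (40 * M.+1)).
Proof.
elim: st => [|[e o] st IH]; first by move=> _; body; [run ltac:(fail)|rewrite /=; lia].
rewrite [all _ _]/= => /andP[/andP[/= le_e _] /IH{}IH].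
by body; [run ltac:(first [eapply fev_lt_nat|eapply IH])|rewrite /=; lia].
Qed.

Lemma fev_newbit B x q y M : ok_enc_entry M q ->
  fev NEWBIT (Node (bool_tree x) (Node (enc_entry q) (Node (bool_tree y) (bits B))))
    (bool_tree (newbit B x q y)) (100 * M.+1).
Proof.
case: x; last by move=> _; body; [run ltac:(fail)|rewrite /=; lia].
case: q => [row|] /= ok_q; last by body; [run ltac:(fail)|rewrite /=; lia].
by case E: (count id _) => [|m] /=;
  (body; [run ltac:(first [eapply fev_andn|eapply fev_cnt])|rewrite size_andn; lia]).
Qed.

Lemma fev_newset B S Q ys M : all (ok_enc_entry M) Q ->
  fev NEWSET (Node (bits S) (Node (list_tree (map enc_entry Q)) (Node (bits ys) (bits B))))
    (bits (newset B S Q ys)) ((size S).+1 * (200 * M.+1)).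
Proof.
elim: S Q ys => [|x S IH] [|q Q] [|y ys]; rewrite [all _ _]/= => ok_Q;
  try by body; [run ltac:(fail)|rewrite /=; lia].
case/andP: ok_Q => ok_q /IH{}IH.
by body; [run ltac:(first [eapply (fev_newbit _ _ _ ok_q)|eapply IH])|rewrite /=; lia].
Qed.

Lemma size_newset B S Q ys : size (newset B S Q ys) <= size S.
Proof. by rewrite size_map size_zip geq_minl. Qed.

Lemma fev_try i S Q st M : all (ok_enc_entry M) Q -> all (ok_cell M) st ->
  size S <= M -> size st <= M ->
  fev TRY (Node (nat_tree i) (Node (bits S) (Node (list_tree (map enc_entry Q)) (enc_st st))))
    (enc_entry (try_levels i S Q st)) (i.+1 * (500 * M.+1 ^ 2)).
Proof.
move=> ok_Q ok_st le_S le_st; elim: i => [|i IH].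
  by body; [run ltac:(fail)|rewrite expnS; lia].
have hB := fev_below i.+1 ok_st.
have hT := fev_newset (below st i.+1) S (below st i.+1) ok_Q.
have cost1 : (size st).+1 * (40 * M.+1) <= 40 * M.+1 ^ 2.
  by rewrite mulnCA leq_mul2l /= expnS expn1 leq_mul2r ltnS le_st.
have cost2 : (size S).+1 * (200 * M.+1) <= 200 * M.+1 ^ 2.
  by rewrite mulnCA leq_mul2l /= expnS expn1 leq_mul2r ltnS le_S.
have cost3 : M.+1 <= M.+1 ^ 2 by rewrite expnS expn1 leq_pmulr.
have := size_newset (below st i.+1) S Q (below st i.+1).
have := count_size id (newset (below st i.+1) S Q (below st i.+1)).
case E: (count id (newset (below st i.+1) S Q (below st i.+1)) < count id S) => leT leT';
  rewrite [try_levels _ _ _ _]/= E;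
  (body; [run ltac:(first [eapply hB|eapply hT|eapply fev_cnt
    |eapply fev_lt_nat|eapply IH])|rewrite /=; lia]).
Qed.

Lemma fev_half l : fev HALF (list_tree l) (nat_tree (size l)./2) (20 * (size l).+1).
Proof.
have [m] := ubnP (size l); elim: m l => // m IH [|x [|y l]] lt_m;
  try by body; [run ltac:(fail)|rewrite /=; lia].
have {}IH := IH l ltac:(rewrite /= in lt_m; lia).
by body; [run ltac:(eapply IH)|rewrite /=; lia].
Qed.

Lemma lgS n : 0 < n -> lg n = (lg n./2).+1.
Proof.
case: n => [|[|n]] // _; rewrite {1}/lg /= trunc_log2S //=.
Qed.

(** The lengths halve, so the costs of the passes form a geometric series. *)
Lemma fev_lg l : fev LG (list_tree l) (nat_tree (lg (size l))) (100 * (size l).+1).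
Proof.
have [m] := ubnP (size l); elim: m l => // m IH [|x l] lt_m.
  by body; [run ltac:(fail)|rewrite /=; lia].
have {}IH := IH (nseq (size (x :: l))./2 Leaf) ltac:(rewrite size_nseq /= in lt_m *; lia).
rewrite size_nseq in IH; rewrite lgS //.
by body; [run ltac:(first [eapply (fev_half (x :: l))|eapply IH])|rewrite /=; lia].
Qed.

Lemma fev_mk k b :
  fev MK (Node (nat_tree k) (nat_tree b)) (nat_tree (beta.+1 * uphalf k + b))
    ((10 + 2 * beta.+1) * k.+1).
Proof.
have [m] := ubnP k; elim: m k => // m IH [|[|k]] lt_m.
- by rewrite muln0; body; [run ltac:(fail)|rewrite /=; lia].
- rewrite muln1; body.
    eapply ev_case; [run idtac|reduce_scrutinee].
    eapply ev_case; [run idtac|reduce_scrutinee].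
    eapply ev_case; [run idtac|reduce_scrutinee].
    by eapply ev_add_expr; run idtac.
  by lia.
have {}IH := IH k ltac:(lia).
rewrite /= mulnS -addnA; body.
  eapply ev_case; [run idtac|reduce_scrutinee].
  eapply ev_case; [run idtac|reduce_scrutinee].
  eapply ev_case; [run idtac|reduce_scrutinee].
  by eapply ev_add_expr; run ltac:(eapply IH).
by lia.
Qed.

(** * Running times of one test and of the whole enumeration *)

Section Run.
Variables (rows : seq (seq bool)) (S : seq bool).
Hypotheses (size_rows : size rows = size S) (size_row : all (fun r => size r == size S) rows).

Notation test := (test beta rows S).
Notation search := (search beta rows S).
Notation n := (size S).

(** The auction gives the fourth power: about [n ^ 2] rounds, each of quadratic cost. *)
Lemma fev_test f w (X := n + size f + 2) :
  fev TEST (Node (bits f) (Node (bits w) (Node (list_tree (map bits rows)) (bits S))))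
    (enc_entry (test f w)) (3000 * beta.+1 * X ^ 4).
Proof.
set g := green S f w; set Q := queue beta rows S g.
have le_rows : all (fun r => size r <= n.+1) rows.
  by apply: sub_all size_row => r /eqP->.
have hgen : fev GEN (Node (bits S) (Node (bits w) (bits f))) _ _ :=
  fev_gen (map bool_tree S) w f.
rewrite size_map in hgen.
have hdegs := fev_degs le_rows.
have hq := fev_buildq g (andn g (low beta rows)) S g (low beta rows) le_rows.
have huna : fev UNA (bits S) _ _ := fev_una (map bool_tree S).
rewrite size_map in huna.
have hinit : fev INIT (Node (bits S) (nat_tree n.+1)) _ _ :=
  fev_init (map bool_tree S) n.+1.
rewrite size_map in hinit.
have ok_Q : all (ok_enc_entry n.+1) Q.
  apply/(all_nthP None) => i; rewrite size_map => lt_i.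
  rewrite (nth_map ([::], (false, false))) // /entry; case: ifP => // _.
  rewrite /= size_andn nth_zip_cond lt_i /=.
  have lt_ir : i < size rows.
    by move: lt_i; rewrite size_zip leq_min => /andP[].
  by have /eqP-> := all_nthP [::] size_row i lt_ir.
have ok_init : all (ok_cell n.+1) (init_st S).
  by rewrite all_nseq /ok_cell /= leqnn orbT.
have hloop := @fev_bidding n.+1 (size Q + load (init_st S)).+1 Q (init_st S) ok_Q ok_init (leqnn _).
have ok_auct := ok_bidding (size Q + load (init_st S)).+1 ok_Q ok_init.
have htry := @fev_try n.+1 S Q (auction S Q) n.+1 ok_Q ok_auct (leqnSn _)
  ltac:(by rewrite size_bidding size_nseq).
body.
  by run ltac:(first [eapply hgen|eapply hdegs|eapply hq|eapply huna|eapply hinit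
    |eapply hloop|eapply htry|eapply fev_andn]).
rewrite size_rows size_andn.
have size_Q : size Q <= n by rewrite size_map size_zip -size_rows geq_minl.
(* At most [n] queue entries, and [n] cells that start at level [n + 1]. *)
have fuelE : size Q + load (init_st S) <= n * n.+2.
  rewrite /load map_nseq sumn_nseq /= mulnC; lia.
have leX : n.+2 <= X by rewrite /X; lia.
have leF : (size f).+2 <= X by rewrite /X; lia.
clearbody X; clear - leX leF fuelE.
have X2 : X * X = X ^ 2 by rewrite expnS expn1.
have X3 : X * X <= X ^ 4 by rewrite X2 leq_pexp2l //; lia.
have X1 : X <= X ^ 4 by rewrite -{1}[X]expn1 leq_pexp2l //; lia.
have X0 : 0 < X ^ 4 by rewrite expn_gt0; lia.
have c1 : n.+1 * (200 * (size f).+1) <= 200 * X ^ 4.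
  by rewrite mulnCA leq_mul2l /=; apply: leq_trans X3; apply: leq_mul; lia.
have c2 : n.+1 * (100 * (n.+1 + beta).+1) <= 100 * (X ^ 4 * beta.+1).
  rewrite mulnCA leq_mul2l /=; apply: (@leq_trans (X * (X * beta.+1))).
    by apply: leq_mul; [lia|rewrite mulnS; nia].
  by rewrite mulnA leq_mul2r X3 orbT.
have c3 : n.+1 * (300 * n.+2) <= 300 * X ^ 4.
  by rewrite mulnCA leq_mul2l /=; apply: leq_trans X3; apply: leq_mul; lia.
have c4 : (size Q + load (init_st S)).+1 * (300 * n.+2 ^ 2) <= 300 * X ^ 4.
  rewrite mulnCA leq_mul2l /= (expnD X 2 2); apply: leq_mul; rewrite ?leq_exp2r // -X2.
  by apply: leq_trans (leq_mul leX leX); nia.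
have c5 : n.+2 * (500 * n.+2 ^ 2) <= 500 * X ^ 4.
  rewrite mulnCA leq_mul2l /=; apply: (@leq_trans (X ^ 3)).
    by rewrite (expnS X); apply: leq_mul; rewrite ?leq_exp2r.
  by rewrite leq_pexp2l //; lia.
rewrite -mulnA [beta.+1 * _]mulnC mulnS; rewrite mulnS in c2; lia.
Qed.

Lemma fev_search m f w (X := n + size f + m + 2) :
  fev ENUM (Node (nat_tree m) (Node (bits f) (Node (bits w)
              (Node (list_tree (map bits rows)) (bits S)))))
    (enc_entry (search m f w)) (4 ^ m * (3000 * beta.+1 * X ^ 4 + 400)).
Proof.
(* The induction keeps a reserve of 200: four recursive calls leave 800, from which a node pays its
   own overhead and keeps 200 again. *)
apply: (@ev_le _ _ _ _ (4 ^ m * (3000 * beta.+1 * X ^ 4 + 400) - 200)); last exact: leq_subr.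
rewrite {}/X; elim: m f w => [|m IH] f w.
  by body; [run ltac:(eapply fev_test)|rewrite addn0; lia].
have := (IH (false :: f) (false :: w), IH (false :: f) (true :: w),
         IH (true :: f) (false :: w), IH (true :: f) (true :: w)).
(* [f] gains a bit whenever [m] loses one, so [X] is the same at every depth. *)
have eX : n + (size f).+1 + m + 2 = n + size f + m.+1 + 2 by lia.
rewrite [size (_ :: _)]/= [size (_ :: _)]/= !eX; set K := 3000 * _ * _.
have P_ge : 400 <= 4 ^ m * (K + 400).
  by rewrite (leq_trans (leq_addl K 400)) // leq_pmull // expn_gt0.
rewrite expnS -mulnA; move: (4 ^ m * (K + 400)) P_ge => P P_ge.
case=> [[[h1 h2] h3] h4] /=.
case E1: (search m (false :: f) (false :: w)) h1 => [T|] h1 /=;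
 [|case E2: (search m (false :: f) (true :: w)) h2 => [T|] h2 /=;
 [|case E3: (search m (true :: f) (false :: w)) h3 => [T|] h3 /=]];
 (body; [run ltac:(first [eapply h1|eapply h2|eapply h3|eapply h4])|rewrite /=; lia]).
Qed.

Lemma fev_main k (m := beta.+1 * uphalf k + lg n) :
  fev MAIN (Node (list_tree (map bits rows)) (Node (bits S) (Node (nat_tree k) Leaf)))
    (enc_entry (search m [::] [::]))
    (4 ^ m * (3000 * beta.+1 * (n + m + 2) ^ 4 + 400) + (10 + 2 * beta.+1) * k.+1
      + 100 * n.+1 + 100).
Proof.
have hlg : fev LG (bits S) _ _ := fev_lg (map bool_tree S).
rewrite size_map in hlg.
have hs := fev_search m [::] [::]; rewrite addn0 in hs.
by body; [run ltac:(first [eapply hlg|eapply fev_mk|eapply hs])|rewrite /=; lia].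
Qed.

End Run.
End Program.

(** * The auction *)

Definition subb (B a : seq bool) : bool := count id (andn a B) == 0.

Lemma count_id_eq0P (l : seq bool) : reflect (forall i, ~~ nth false l i) (count id l == 0).
Proof.
rewrite eqn0Ngt -has_count; apply: (iffP idP) => [h i|h].
  have [lt_i|le_i] := ltnP i (size l); last by rewrite nth_default.
  by apply: contra h => li; apply/(has_nthP false); exists i.
by apply/negP => /(has_nthP false)[i _ li]; have := h i; rewrite li.
Qed.

Lemma subbP B a : reflect (forall u, nth false a u -> nth false B u) (subb B a).
Proof.
apply: (iffP (count_id_eq0P _)) => h u; have := h u; rewrite nth_andn.
  by case: (nth false a u) => //=; rewrite negbK.
by move=> hu; case: (nth false a u) hu => //= ->.
Qed.

Lemma meet0P a b :
  reflect (forall u, nth false a u -> ~~ nth false b u) (meet a b == 0).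
Proof.
apply: (iffP (count_id_eq0P _)) => h u; have := h u; rewrite !nth_andn;
  by case: (nth false a u) => //=; rewrite ?negbK // => ->.
Qed.

Lemma place_bid_hit a st (c0 : cell) (p := max_level a st 0) 
    (r := place_bid a st p (Some a)) : 0 < p ->
  exists u, [/\ u < size st, nth false a u, (nth c0 st u).1 = p,
    r.1 = (nth c0 st u).2 & r.2 = set_nth c0 st u (p.-1, Some a)].
Proof.
move=> p_gt0; rewrite {}/r.
have [[u [lt_u au le_p -> ->]]|[lt_p _]] := place_bid_cases a st p (Some a) c0.
  have e : (nth c0 st u).1 = p by apply/anti_leq; rewrite le_p max_level_ge.
  by exists u; rewrite e.
have [e|[u [lt_u au e]]] := max_level_cases a st 0 c0; first by rewrite /p e in p_gt0.
by have := lt_p u lt_u au; rewrite e ltnn.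
Qed.

Section Auction.
Variables (n : nat) (Q : seq (option (seq bool))).
Notation c0 := (0, None : option (seq bool)).
Implicit Types (st : seq cell) (W : seq (option (seq bool))) (D : seq (seq bool)).

(* [st] holds the owners, [W] the rows waiting to bid and [D] the rows that gave up.
   The level of a cell is what remains of its capacity, so a bid goes to a cell of
   maximal level and lowers it. *)
Definition auction_inv st W D : Prop :=
  [/\ perm_eq (pmap id Q) (pmap snd st ++ pmap id W ++ D),
      forall u a, u < n -> (nth c0 st u).2 = Some a ->
        nth false a u /\
        forall u', u' < n -> nth false a u' -> (nth c0 st u').1 <= (nth c0 st u).1.+1,
      forall u, u < n -> (nth c0 st u).2 = None -> (nth c0 st u).1 = n.+1,
      forall a, a \in D -> forall u, u < n -> nth false a u -> (nth c0 st u).1 = 0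
    & size st = n].

(** Levels never rise, and only the chosen cell changes. It falls from the bidder's maximum [p] to
    [p - 1], which is the slack of one granted to the new owner; the evicted row rejoins the
    queue. *)
Lemma auction_inv_bid st W D a (p := max_level a st 0) (r := place_bid a st p (Some a)) : 0 < p ->
  auction_inv st (Some a :: W) D -> auction_inv r.2 (r.1 :: W) D.
Proof.
move=> p_gt0 [I1 I2 I3 I4 I5]; have [u [lt_u au eu e1 e2]] := place_bid_hit c0 p_gt0.
have levels v : (nth c0 r.2 v).1 = if v == u then p.-1 else (nth c0 st v).1.
  by rewrite /r e2 nth_set_nth /=; case: eqP.
have owners v : (nth c0 r.2 v).2 = if v == u then Some a else (nth c0 st v).2.
  by rewrite /r e2 nth_set_nth /=; case: eqP.
have level_le v : (nth c0 r.2 v).1 <= (nth c0 st v).1.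
  by rewrite levels; case: eqP => // ->; rewrite eu leq_pred.
split.
- apply/permP => P; move/permP/(_ P): I1 => ->.
  rewrite /r e1 e2 set_nthE lt_u -{1}(cat_take_drop u st) (drop_nth c0 lt_u).
  rewrite !pmap_cat /=; case: (nth c0 st u) => e [b|]; rewrite /= ?count_cat /= ?count_cat /=; lia.
- move=> v b lt_v; rewrite owners levels; case: eqP => [->|_].
    case=> <-; split=> // u' lt_u' au'; rewrite (leq_trans (level_le _)) // prednK //.
    by apply: max_level_ge => //; rewrite I5.
  case/I2=> // bv le_b; split=> // u' lt_u' bu'.
  exact: leq_trans (level_le _) (le_b _ lt_u' bu').
- by move=> v lt_v; rewrite owners levels; case: eqP => // _; apply: I3.
- move=> b bD v lt_v bv; apply/eqP; rewrite -leqn0 (leq_trans (level_le _)) //.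
  by rewrite (I4 b).
by rewrite /r size_place_bid.
Qed.

Lemma auction_inv_drop st W D a : max_level a st 0 = 0 ->
  auction_inv st (Some a :: W) D -> auction_inv st W (a :: D).
Proof.
move=> p0 [I1 I2 I3 I4 I5]; split=> //.
  apply/permP => P; move/permP/(_ P): I1 => ->; rewrite !count_cat /=.
  by lia.
move=> b; rewrite inE => /orP[/eqP-> u lt_u au|]; last exact: I4.
by apply/eqP; rewrite -leqn0 -p0; apply: max_level_ge => //; rewrite I5.
Qed.

Lemma auction_inv_bidding fuel st W D : size W + load st < fuel -> auction_inv st W D ->
  exists D', auction_inv (bidding fuel W st) [::] D'.
Proof.
elim: fuel st W D => // fuel IH st [|[a|] W] D /= lt_fuel I.
- by exists D.
- case: eqP => [p0|/eqP]; first by apply: IH (auction_inv_drop p0 I); lia.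
  rewrite -lt0n => p_gt0; apply: IH (auction_inv_bid p_gt0 I).
  by have := load_place_bid (Some a) p_gt0 (erefl _); rewrite /=; lia.
by apply: (IH st W D); [lia|].
Qed.

(** A cell has at most one owner, so the rows counted inject into the cells of [B]. *)
Lemma count_owners_le (P : pred (seq bool)) st B :
  (forall u a, u < size st -> (nth c0 st u).2 = Some a -> P a -> nth false B u) ->
  count P (pmap snd st) <= count id B.
Proof.
elim: st B => // [[e o] st] IH B own.
have IH' : count P (pmap snd st) <= count id (behead B).
  by apply: IH => u a lt_u eu Pa; rewrite nth_behead; exact: (own u.+1 a).
have le_B : head false B + count id (behead B) <= count id B by case: (B).
rewrite /=; case: o own => [a|] own /=; last by lia.
case Pa: (P a); last by lia.
by have := own 0 a isT (erefl _) Pa; rewrite nth0 => hB; rewrite hB in le_B; lia.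
Qed.

(** Pigeonhole: [n] cells cannot occupy [n + 1] levels. *)
Lemma level_gap st : size st <= n -> exists2 i, 0 < i <= n.+1 & i \notin map fst st.
Proof.
move=> le_n; have: ~~ all (mem (map fst st)) (iota 1 n.+1).
  apply/negP => /allP sub; have := uniq_leq_size (iota_uniq 1 n.+1) sub.
  by rewrite size_iota size_map ltnNge le_n.
by rewrite -has_predC => /hasP[i]; rewrite mem_iota add1n ltnS; exists i.
Qed.

(* There are [n] cells, so some level [i] in [1 .. n+1] is vacant.  An owner of a cell
   below [i] has all its neighbours at most one level higher, hence below [i]; a
   violation of Hall's condition forces some row to give up, and it adds one. *)
Lemma hall_violator_level st D B : all (ok_enc_entry n) Q -> auction_inv st [::] D ->
  count id B < count (subb B) (pmap id Q) ->
  exists2 i, 0 < i <= n.+1 & count id (below st i) < count (subb (below st i)) (pmap id Q).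
Proof.
move=> okQ [/permP perm I2 I3 I4 I5] viol.
have [i i_range gap] := level_gap (eq_leq I5); exists i => //.
(* A row has no bits beyond the cells, so control over the cells controls the whole row. *)
have memQ a : a \in pmap id Q -> size a <= n.
  by rewrite mem_pmap map_id => /(allP okQ).
have D_gt0 : 0 < size D.
  case: D perm {I4} => // perm; move: viol; rewrite perm !count_cat /= !addn0.
  rewrite ltnNge count_owners_le // => u a; rewrite I5 => lt_u e /subbP; apply.
  by have [] := I2 u a lt_u e.
have perm' : perm_eq (pmap id Q) (pmap snd st ++ D) by apply/permP => P; rewrite perm.
have nth_below u : u < n -> nth false (below st i) u = ((nth c0 st u).1 < i).
  by move=> lt_u; rewrite (nth_map c0) // I5.
have sub_low a : a \in pmap id Q ->
    (forall u, u < n -> nth false a u -> (nth c0 st u).1 < i) -> subb (below st i) a.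
  move=> /memQ size_a low; apply/subbP => u au.
  have lt_u : u < n.
    by rewrite ltnNge; apply/negP => le_u; rewrite nth_default ?(leq_trans size_a) in au.
  by rewrite nth_below // low.
have allD : all (subb (below st i)) D.
  apply/allP => a aD; apply: sub_low; first by rewrite (perm_mem perm') mem_cat aD orbT.
  by move=> u lt_u au; rewrite (I4 a) //; case/andP: i_range.
rewrite perm !count_cat /= (all_count _ _ : all _ D = _) in allD *.
have -> : count (subb (below st i)) D = size D by apply/eqP.
suff : count id (below st i) <= count (subb (below st i)) (pmap snd st) by lia.
rewrite count_map; move: (subb (below st i)) sub_low {allD} => P sub_low.
have own c : c \in st -> c.1 < i -> if c.2 is Some a then P a else false.
  move=> c_st lt_i; have lt_c : index c st < n by rewrite -I5 index_mem.
  have ec := nth_index c0 c_st; case e: c.2 => [a|].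
    have [|_ le_a] := I2 _ a lt_c; first by rewrite ec.
    apply: sub_low.
      by rewrite (perm_mem perm') mem_cat mem_pmap -e map_f.
    move=> u lt_u au; rewrite ltn_neqAle; apply/andP; split.
      by apply: contra gap => /eqP <-; rewrite map_f // mem_nth // I5.
    by apply: leq_trans (le_a u lt_u au) _; rewrite ec.
  (* An unowned cell has never been bid for; its level [n + 1] is not below [i]. *)
  have := I3 _ lt_c; rewrite ec => /(_ e) ec1; case/andP: i_range => _ i_le.
  by rewrite ec1 ltnNge i_le in lt_i.
elim: st own {I2 I3 I4 I5 gap perm perm' nth_below sub_low} => //= c st IH own.
have {}IH : count (preim (fun c' : cell => c'.1 < i) id) st <= count P (pmap snd st).
  by apply: IH => c' c'_st; apply: own; rewrite inE c'_st orbT.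
have := own c (mem_head _ _); rewrite /=; case: (c.1 < i) => [/(_ isT)|_].
  by case: c.2 => [a|] //= ->; rewrite leq_add2l.
by case: c.2 => [a|] //=; rewrite add0n (leq_trans IH) ?leq_addl.
Qed.

End Auction.

Lemma auction_complete (S : seq bool) Q B (st := auction S Q) :
  all (ok_enc_entry (size S)) Q -> count id B < count (subb B) (pmap id Q) ->
  exists2 i, 0 < i <= (size S).+1 & count id (below st i) < count (subb (below st i)) (pmap id Q).
Proof.
move=> okQ; have init : auction_inv (size S) Q (init_st S) Q [::].
  have nth_init u : u < size S -> nth (0, None) (init_st S) u = ((size S).+1, None).
    by move=> lt_u; rewrite nth_nseq lt_u.
  split=> //; last by rewrite size_nseq.
  - suff -> : pmap snd (init_st S) = [::] by rewrite cats0.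
    by rewrite /init_st; elim: {1}(size S).
  - by move=> u a lt_u; rewrite nth_init.
  - by move=> u lt_u; rewrite nth_init.
have [D inv_end] := auction_inv_bidding (leqnn _) init.
exact: hall_violator_level okQ inv_end.
Qed.

(** Each row inside [B] removes its bidder from [S], and at most the bits of [ys] are added. A
    violation of Hall's condition thus makes the new set smaller. *)
Lemma count_newset B S Q ys :
  size Q = size S -> size ys = size S ->
  (forall i, nth None Q i -> nth false S i) ->
  count id (newset B S Q ys) + count (subb B) (pmap id Q) <= count id S + count id ys.
Proof.
elim: S Q ys => [|x S IH] [|q Q] [|y ys] //= [eQ] [ey] imp.
have {}IH := IH Q ys eQ ey (fun i => imp i.+1).
have := imp 0; rewrite /newset /= /newbit -/(newset B S Q ys) in IH *.
case: q {imp} => [row|] /= imp; last by case: x {imp}; lia.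
by rewrite imp // -/(subb B row) /=; case: (subb B row); lia.
Qed.

Lemma try_sound i S Q st T : try_levels i S Q st = Some T ->
  exists2 B, T = newset B S Q B & count id T < count id S /\ exists j, B = below st j.
Proof.
elim: i => //= i IH; case: ifP => // lt_T [<-]; exists (below st i.+1) => //; split => //.
by exists i.+1.
Qed.

Lemma try_complete k i S Q st (B := below st i) : 0 < i <= k ->
  count id (newset B S Q B) < count id S -> try_levels k S Q st.
Proof.
elim: k => [|k IH] /andP[i_gt0]; first by rewrite leqNgt i_gt0.
rewrite leq_eqVlt => /orP[/eqP eik|lt_ik] lt_S /=; first by rewrite -eik -/B lt_S.
by case: ifP => // _; apply: IH => //; rewrite i_gt0.
Qed.

Lemma search_sound beta rows S m f w T : search beta rows S m f w = Some T ->
  exists f' w', test beta rows S f' w' = Some T.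
Proof.
elim: m f w => [|m IH] f w /=; first by exists f, w.
rewrite /orelse; do 3!(case E: (search _ _ _ _ _ _) => [T'|];
  [by case=> eT; rewrite eT in E; apply: IH E|clear E]).
exact: IH.
Qed.

(** The search puts new bits in front, so the pair that is finally tested is reversed. *)
Lemma search_complete beta rows S f' w' f w : size f' = size w' ->
  test beta rows S (catrev f' f) (catrev w' w) -> search beta rows S (size f') f w.
Proof.
elim: f' w' f w => [|b f' IH] [|c w'] //= f w [eq_size] /(IH _ _ _ eq_size) h.
have orelseE T (o o' : option T) : orelse o o' = o || o' :> bool by case: o.
by rewrite !orelseE; case: b c h => [] [] ->; rewrite ?orbT.
Qed.

(** * Graphs *)

Definition bitv n (A : {set 'I_n}) : seq bool := [seq i \in A | i <- enum 'I_n].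

Lemma size_bitv n (A : {set 'I_n}) : size (bitv A) = n.
Proof. by rewrite size_map size_enum_ord. Qed.

Lemma nth_bitv n (A : {set 'I_n}) (i : 'I_n) : nth false (bitv A) i = (i \in A).
Proof. by rewrite (nth_map i) ?size_enum_ord ?nth_ord_enum. Qed.

Lemma count_bitv n (A : {set 'I_n}) : count id (bitv A) = #|A|.
Proof. by rewrite count_map -sum1_count big_enum_cond -sum1_card; apply: eq_bigl. Qed.

Lemma bitv_nth n (l : seq bool) : size l = n -> bitv [set i : 'I_n | nth false l i] = l.
Proof.
move=> size_l; apply: (@eq_from_nth _ false) => [|i]; rewrite size_bitv // => lt_i.
by rewrite (nth_bitv _ (Ordinal lt_i)) inE.
Qed.

Section Graph.
Variables (beta n : nat) (G : sgraph 'I_n) (S : {set 'I_n}).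

Definition adj_rows : seq (seq bool) := [seq bitv (neighbors G i) | i <- enum 'I_n].
Definition lowdeg : {set 'I_n} := [set i | #|neighbors G i| <= beta].

Notation low := (low beta adj_rows).
Notation queue := (queue beta adj_rows (bitv S)).
Implicit Types (g : {set 'I_n}) (i j : 'I_n).

Lemma low_bitv : low = bitv lowdeg.
Proof. by rewrite /low -map_comp; apply: eq_map => i /=; rewrite count_bitv inE. Qed.

Lemma andn_bitv (A B : {set 'I_n}) : andn (bitv A) (bitv B) = bitv (A :\: B).
Proof.
apply: (@eq_from_nth _ false) => [|i]; rewrite size_andn !size_bitv // => lt_i.
by rewrite nth_andn !(nth_bitv _ (Ordinal lt_i)) inE andbC.
Qed.

Definition survivors (g : {set 'I_n}) : {set 'I_n} :=
  [set i in g | [disjoint neighbors G i & if i \in lowdeg then g else g :\: lowdeg]].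

Lemma size_queue g : size (queue (bitv g)) = n.
Proof. by rewrite size_map !size_zip low_bitv !size_bitv size_map size_enum_ord !minnn. Qed.

Lemma queueE g :
  queue (bitv g) =
  [seq if i \in survivors g then Some (bitv (neighbors G i :\: S)) else None | i <- enum 'I_n].
Proof.
rewrite /queue /buildq low_bitv andn_bitv.
have -> : zip adj_rows (zip (bitv g) (bitv lowdeg)) =
    [seq (bitv (neighbors G i), (i \in g, i \in lowdeg)) | i <- enum 'I_n].
  have zipE T1 T2 (h1 : 'I_n -> T1) (h2 : 'I_n -> T2) s :
      zip (map h1 s) (map h2 s) = [seq (h1 i, h2 i) | i <- s].
    by elim: s => //= i s ->.
  by rewrite /adj_rows [zip (bitv g) _]zipE zipE.
rewrite -map_comp; apply: eq_map => i; rewrite /= /entry andn_bitv [i \in survivors g]inE.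
suff -> : (meet (bitv (neighbors G i))
    (if i \in lowdeg then bitv g else bitv (g :\: lowdeg)) == 0) =
    [disjoint neighbors G i & if i \in lowdeg then g else g :\: lowdeg] by [].
have -> : (if i \in lowdeg then bitv g else bitv (g :\: lowdeg)) =
  bitv (if i \in lowdeg then g else g :\: lowdeg) by case: ifP.
apply/meet0P/pred0P => [h j|h u].
  have := h j; rewrite !nth_bitv /=; case: (j \in neighbors G i) => //= /(_ isT).
  exact: negbTE.
have [lt_u|le_u] := ltnP u n; last by rewrite nth_default // size_bitv.
have := h (Ordinal lt_u); rewrite /= !(nth_bitv _ (Ordinal lt_u)).
by case: (_ \in neighbors G i) => //= ->.
Qed.

Lemma nth_queue g i :
  nth None (queue (bitv g)) i =
  if i \in survivors g then Some (bitv (neighbors G i :\: S)) else None.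
Proof. by rewrite queueE (nth_map i) ?size_enum_ord // nth_ord_enum. Qed.

(** A low end of an edge is excluded by any green neighbour; when both ends are high, each excludes
    the other. *)
Lemma survivors_independent g i j : i \in survivors g -> j \in survivors g -> ~~ G i j.
Proof.
rewrite !inE => /andP[gi di] /andP[gj dj]; apply/negP => Gij.
have Gji : G j i by rewrite adj_sym.
have out a b (A : {set 'I_n}) : G a b -> [disjoint neighbors G a & A] -> b \notin A.
  by move=> Gab /disjointFr->; rewrite ?inE.
move: (out _ _ _ Gij di) (out _ _ _ Gji dj).
case: ifP => li; rewrite ?inE gj ?andbT //.
by case: ifP => lj; rewrite ?inE gi ?andbT // ?negbK // inE li.
Qed.

Lemma ok_queue g : all (ok_enc_entry n) (queue (bitv g)).
Proof. by rewrite queueE all_map; apply/allP => i _ /=; case: ifP => //= _; rewrite size_bitv. Qed.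

Lemma count_queue g (P : pred (seq bool)) :
  count P (pmap id (queue (bitv g))) =
  #|[set i in survivors g | P (bitv (neighbors G i :\: S))]|.
Proof.
rewrite queueE; transitivity (count (fun i => (i \in survivors g) &&
    P (bitv (neighbors G i :\: S))) (enum 'I_n)).
  by elim: (enum 'I_n) => //= i s; case: (i \in survivors g) => //= ->.
by rewrite -sum1_count big_enum_cond -sum1_card; apply: eq_bigl => i; rewrite [RHS]inE.
Qed.

(** In an uncovered edge an end in [S] has left, so it survived and its neighbours outside [S] lie
    in [B]. The other end is then chosen with [B], or it has left [S] too and the edge joins two
    survivors. *)
Lemma newset_cover g B (st : seq cell) (k : nat) :
  size st = n -> B = below st k -> g \subset S -> vertex_cover G S ->
  vertex_cover G [set i : 'I_n | nth false (newset B (bitv S) (queue (bitv g)) B) i].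
Proof.
move=> size_st eB gS coverS.
have size_B : size B = n by rewrite eB size_map.
have bitE i : nth false (newset B (bitv S) (queue (bitv g)) B) i =
    newbit B (i \in S) (nth None (queue (bitv g)) i) (nth false B i).
  rewrite (nth_map (false, (None, false))).
    by rewrite !nth_zip ?size_zip ?size_queue ?size_bitv ?size_B ?minnn //= nth_bitv.
  by rewrite !size_zip size_queue size_bitv size_B !minnn.
have missed i : ~~ newbit B (i \in S) (nth None (queue (bitv g)) i) (nth false B i) ->
    i \in S -> i \in survivors g /\ forall j, G i j -> j \notin S -> nth false B j.
  rewrite nth_queue /newbit; case: ifP => // _; case: ifP => // sur.
  rewrite negbK => /subbP sub _; split=> // j Gij jS; apply: sub.
  by rewrite nth_bitv !inE jS.
move=> u v Guv; rewrite !inE !bitE; apply/negPn/negP; rewrite negb_or => /andP[mu mv].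
wlog uS : u v Guv mu mv / u \in S => [W|].
  have /orP[] := coverS _ _ Guv; first exact: W mu mv.
  by move=> vS; apply: W mv mu vS; rewrite adj_sym.
have [su nbr] := missed u mu uS; have [vS|vS] := boolP (v \in S).
  have [sv _] := missed v mv vS.
  by have := survivors_independent su sv; rewrite Guv.
by move: mv; rewrite /newbit (negbTE vS) nbr.
Qed.

Lemma test_green f w : exists2 g : {set 'I_n}, g \subset S &
  green (bitv S) f w = bitv g /\
  g = S :\: [set i : 'I_n | nth false (gen n w f) i].
Proof.
exists (S :\: [set i : 'I_n | nth false (gen n w f) i]); first exact: subsetDl.
split=> //; rewrite /green size_bitv; apply: (@eq_from_nth _ false) => [|i];
  rewrite size_andn !size_bitv // => lt_i.
by rewrite nth_andn !(nth_bitv _ (Ordinal lt_i)) !inE andbC.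
Qed.

(** Every colouring is safe: the exchange always gives a cover, and [try_levels] checks the decrease
    in size itself. *)
Lemma test_sound f w T : vertex_cover G S ->
  test beta adj_rows (bitv S) f w = Some T ->
  exists S' : {set 'I_n}, [/\ T = bitv S', vertex_cover G S' & #|S'| < #|S|].
Proof.
move=> coverS; have [g gS [eg _]] := test_green f w; rewrite /test eg.
move=> /try_sound[B eT [lt_T [j eB]]].
have size_st : size (auction (bitv S) (queue (bitv g))) = n.
  by rewrite size_bidding size_nseq size_bitv.
have size_T : size T = n.
  by rewrite eT eB size_map !size_zip size_queue size_bitv size_map size_st !minnn.
exists [set i : 'I_n | nth false T i]; rewrite -!count_bitv bitv_nth //; split=> //.
by rewrite eT; exact: (newset_cover size_st eB gS coverS).
Qed.

(** The neighbours of [A] outside [S] contain the rows of all bidders in [A], so they violate Hall's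
    condition; the auction turns this into a violating level set. *)
Lemma test_complete f w (A : {set 'I_n}) (g := S :\: [set i : 'I_n | nth false (gen n w f) i]) :
  A \subset survivors g ->
  #|(\bigcup_(i in A) neighbors G i) :\: S| < #|A| ->
  test beta adj_rows (bitv S) f w.
Proof.
move=> subA lt_A; have [g' gS [eg eg']] := test_green f w; rewrite /test eg.
rewrite -/g in eg'; subst g'.
pose B := bitv ((\bigcup_(i in A) neighbors G i) :\: S).
have viol : count id B < count (subb B) (pmap id (queue (bitv g))).
  rewrite count_bitv count_queue; apply: leq_trans lt_A (subset_leq_card _).
  apply/subsetP => i iA; rewrite inE (subsetP subA) //=; apply/subbP => u.
  have [lt_u|le_u] := ltnP u n; last by rewrite nth_default // size_bitv.
  rewrite !(nth_bitv _ (Ordinal lt_u)) 2!inE => /andP[uS iu].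
  by rewrite inE uS; apply/bigcupP; exists i; rewrite ?inE.
have okQ : all (ok_enc_entry (size (bitv S))) (queue (bitv g)) by rewrite size_bitv ok_queue.
have [i i_range lt_i] := auction_complete okQ viol.
apply: (try_complete i_range).
set st := auction _ _ in lt_i *.
have := @count_newset (below st i) (bitv S) (queue (bitv g)) (below st i).
rewrite size_queue size_bitv size_map size_bidding size_nseq size_bitv.
move=> /(_ erefl erefl) le_new.
suff imp u : nth None (queue (bitv g)) u -> nth false (bitv S) u by have := le_new imp; lia.
have [lt_u|le_u] := ltnP u n; last by rewrite nth_default // size_queue.
rewrite (nth_queue _ (Ordinal lt_u)) (nth_bitv _ (Ordinal lt_u)); case: ifP => // + _.
by rewrite inE => /andP[/(subsetP gS)].
Qed.

End Graph.

(** * Colourings from linear recurrences *)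

Lemma meetE a b : meet a b = \sum_(j < size a) (nth false a j && nth false b j).
Proof.
rewrite /meet; elim: a b => [|x a IH] b /=; first by rewrite big_ord0.
rewrite big_ord_recl /=; case: b => [|y b] /=.
  rewrite andbF big1 => [|j _]; last by rewrite ?nth_nil ?andbF.
  by rewrite andbN; elim: a {IH} => //= z a IH; rewrite andbN.
by rewrite IH; congr (_ + _); case: x; case: y.
Qed.

(** Histories list [r] backwards from the newest value. The offset [t] is there for the induction,
    which shifts one step into the history. *)
Lemma gen_recurrence (r : nat -> bool) (f : seq bool) k t (m := size f) :
  (forall t', r (m + t') = odd (\sum_(j < m) (nth false f j && r (m + t' - j.+1)))) ->
  gen k (mkseq (fun j => r (m + t - j.+1)) (m + t)) f =
  mkseq (fun j => r (m + (t + k) - j.+1)) (m + (t + k)).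
Proof.
move=> rec; elim: k t => [|k IH] t; first by rewrite addn0.
have mkseqS (h : nat -> bool) N : mkseq h N.+1 = h 0 :: mkseq (fun j => h j.+1) N.
  by rewrite /mkseq /= (iotaDl 1 0) -map_comp.
rewrite addnS -addSn -IH /=; congr gen; rewrite addnS mkseqS subn1 /= rec.
congr (_ :: _); rewrite /dot meetE; congr odd; apply: eq_bigr => j _.
by rewrite nth_mkseq // (leq_trans (ltn_ord j)) ?leq_addr.
Qed.

Section FiniteField.
Local Open Scope ring_scope.
Import GRing.Theory.

(** Each nonempty subset of [T] gives a nonzero polynomial of degree at most [n], since its
    exponents are distinct; all the roots together do not fill the field. *)
Lemma exists_nonroot (F : finFieldType) n (T : {set 'I_n}) : (n * 2 ^ #|T| < #|F|)%N ->
  exists x : F, forall U : {set 'I_n}, U \subset T -> U != set0 ->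
    x * \sum_(i in U) x ^+ (n - i.+1) != 0.
Proof.
(* The factor ['X] makes the chosen point nonzero as well. *)
move=> lt_F; pose P (U : {set 'I_n}) : {poly F} := 'X * \sum_(i in U) 'X^(n - i.+1).
have hornerP U x : (P U).[x] = x * \sum_(i in U) x ^+ (n - i.+1).
  rewrite hornerM hornerX horner_sum; congr (_ * _).
  by apply: eq_bigr => i _; rewrite hornerXn.
have P_neq0 U : U != set0 -> P U != 0.
  case/set0Pn => i iU; rewrite mulf_neq0 ?polyX_eq0 //.
  apply/eqP => /(congr1 (fun p : {poly F} => p`_(n - i.+1))); rewrite coef0 coef_sum (bigD1 i) //=.
  rewrite coefXn eqxx big1 ?addr0 => [/eqP|j /andP[_ ji]]; first by rewrite oner_eq0.
  rewrite coefXn; case: eqP => // e; case/eqP: ji; apply: val_inj => /=.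
  by have := ltn_ord i; have := ltn_ord j; lia.
have size_P U : (size (P U) <= n.+1)%N.
  rewrite /P mulrC; have [->|nz] := eqVneq (\sum_(i in U) 'X^(n - i.+1) : {poly F}) 0.
    by rewrite mul0r size_poly0.
  rewrite size_mulX // ltnS; apply: (leq_trans (size_sum _ _ _)).
  by apply/bigmax_leqP => i _; rewrite size_polyXn; have := ltn_ord i; lia.
pose bad := \bigcup_(U in powerset T | U != set0) [set x | root (P U) x].
have [x xP] : exists x, x \notin bad.
  apply/existsP; rewrite -negb_forall; apply/negP => /forallP all_bad.
  move: lt_F; rewrite ltnNge => /negP; apply.
  have -> : #|F| = #|bad| by rewrite -cardsT; apply: eq_card => x; rewrite all_bad inE.
  rewrite -card_powerset mulnC -sum_nat_const.
  apply: (@leq_trans (\sum_(U in powerset T | U != set0) #|[set x | root (P U) x]|)%N).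
    rewrite /bad; elim/big_rec2: _ => [|U k A _ le_k]; first by rewrite cards0.
    by rewrite (leq_trans (leq_card_setU _ _)) // leq_add2l.
  rewrite [leqRHS](bigID (fun U => U != set0)) /=; apply: leq_trans (leq_addr _ _).
  apply: leq_sum => U /andP[_ U0]; rewrite -ltnS; apply: leq_trans (size_P U).
  rewrite cardE; apply: max_poly_roots; rewrite ?P_neq0 ?enum_uniq //.
  by apply/allP => y; rewrite mem_enum inE.
exists x => U UT U0; rewrite -hornerP; apply: contra xP => Px.
by apply/bigcupP; exists U; rewrite ?inE ?UT.
Qed.

Lemma F2_natr (c : 'F_2) : c = (c != 0)%:R.
Proof. by case: c => [[|[|]]] // i; apply: val_inj. Qed.

Lemma natr_odd_F2 m : m%:R = (odd m)%:R :> 'F_2.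
Proof. by apply: val_inj; rewrite [LHS]val_Fp_nat // [RHS]val_Fp_nat // !modn2 oddb. Qed.

(** The minimal polynomial over F_2 may have degree below the dimension; a power of ['X] raises it
    to a monic polynomial of exactly that degree. *)
Lemma F2_annihilator (L : fieldExtType 'F_2) (x : L) :
  exists c : nat -> 'F_2, x ^+ \dim {:L} = \sum_(j < \dim {:L}) c j *: x ^+ j.
Proof.
set m := \dim {:L}; pose p := minPoly 1 x * 'X^(m - adjoin_degree 1 x).
have le_m : (adjoin_degree 1 x <= m)%N.
  by rewrite adjoin_degreeE dimv1 divn1 dimvS // subvf.
have size_p : size p = m.+1.
  rewrite size_monicM ?monic_minPoly ?monic_neq0 ?monicXn //.
  by rewrite size_minPoly size_polyXn; lia.
have p_monic : p \is monic by rewrite monicMl ?monic_minPoly ?monicXn.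
have px : p.[x] = 0 by rewrite hornerM minPolyxx mul0r.
have coefp j : exists a : 'F_2, p`_j == a%:A.
  have /polyOverP/(_ j)/vlineP[a ->] : p \is a polyOver 1%VS; last by exists a.
  by rewrite rpredM ?minPolyOver ?polyOverXn.
pose c j := - (xchoose (coefp j)).
exists c; move: p_monic px; rewrite monicE lead_coefE horner_coef size_p big_ord_recr /=.
move=> /eqP ->; rewrite mul1r addrC => /eqP; rewrite addr_eq0 => /eqP ->.
rewrite -sumrN; apply: eq_bigr => j _.
by rewrite scaleNr [in LHS](eqP (xchooseP (coefp j))) mulr_algl.
Qed.

Lemma lfsr_universal n m (T A : {set 'I_n}) : (n * 2 ^ #|T| < 2 ^ m)%N ->
  exists f w : seq bool, [/\ size f = m, size w = m
    & {in T, forall i : 'I_n, nth false (gen n w f) i = (i \in A)}].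
Proof.
case: (posnP m) => [->|m_gt0] lt_m.
  (* For [m = 0] the hypothesis forces [n = 0], and there is nothing to colour. *)
  exists [::], [::]; split=> // i _.
  have n_gt0 : (0 < n)%N by apply: leq_trans (ltn_ord i).
  by move: lt_m; rewrite expn0 ltnS leqn0 muln_eq0 expn_eq0 orbF -leqn0 leqNgt n_gt0.
have [F charF cardF] := PrimePowerField (isT : prime 2) m_gt0.
pose L : fieldExtType 'F_2 := pPrimeCharType charF.
have dimL : \dim {:L} = m by rewrite pprimeChar_dimf cardF pfactorK.
rewrite -cardF in lt_m; have [x xP] := exists_nonroot lt_m.
(* Vertex [i] reads the bit of index [m + (n - (i + 1))]: the first [m] bits are the seed, and the
   newest bit belongs to vertex 0. *)
pose y : L := x; pose X : #|T|.-tuple L := [tuple y ^+ (m + (n - (enum_val i).+1)) | i < #|T|].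
(* Over F_2 a vanishing combination is a vanishing sum over a subset of [T]; dividing by [y ^+ m]
   contradicts the choice of [x]. *)
have freeX : free X.
  apply/freeP => k; rewrite -[0]/(0 : L).
  under eq_bigr => i _ do rewrite (nth_map i) ?size_enum_ord // nth_ord_enum.
  move=> sum0 i0; apply/eqP; apply: contraT => k0.
  pose U : {set 'I_n} := [set enum_val i | i : 'I_#|T| & k i != 0].
  have UT : U \subset T by apply/subsetP => _ /imsetP[i _ ->]; apply: enum_valP.
  have U0 : U != set0.
    by apply/set0Pn; exists (enum_val i0); apply/imsetP; exists i0; rewrite ?inE.
  have nz := xP U UT U0; rewrite mulf_eq0 negb_or in nz; case/andP: nz => x0 sumU.
  case/negP: sumU; have xm0 : y ^+ m != 0 by rewrite expf_neq0.
  apply/eqP/(mulfI xm0); rewrite mulr0 mulr_sumr -[RHS]sum0 /U big_imset /=; last first.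
    by move=> i j _ _; apply: enum_val_inj.
  rewrite big_mkcond /=; apply: eq_bigr => i _.
  rewrite [in RHS](F2_natr (k i)) inE; case: (k i != 0); last by rewrite scale0r.
  by rewrite scale1r exprD.
have [phi phiX] := linear_of_free X [seq ((i \in A)%:R : ('F_2)^o) | i <- enum T].
have {}phiX i : i \in T -> phi (y ^+ (m + (n - i.+1))) = (i \in A)%:R.
  move=> iT; have {}phiX := phiX freeX; rewrite size_map -cardE size_tuple in phiX.
  have {}phiX := phiX erefl.
  have := congr1 (fun s => nth 0 s (enum_rank_in iT i)) phiX.
  rewrite (nth_map 0) ?size_tuple // (nth_map i) -?cardE //.
  by rewrite -tnth_nth tnth_mktuple enum_rankK_in // (nth_enum_rank_in i iT iT).
have [c cP] := F2_annihilator y; rewrite dimL in cP.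
pose r t : bool := phi (y ^+ t) != 0.
(* The newest bit comes first in the history, so the coefficients are listed from the highest index
   down. *)
pose f := mkseq (fun j => c (m - j.+1)%N != 0) m.
pose w := mkseq (fun j => r (m - j.+1)%N) m.
have size_f : size f = m by rewrite size_mkseq.
exists f, w; split=> // [|i iT]; first by rewrite size_mkseq.
have := @gen_recurrence r f n 0%N; cbv zeta; rewrite size_f add0n addn0 => ->; last first.
  (* Booleans embed into F_2, where parity becomes a sum and the linearity of [phi] applies. *)
  move=> t; apply: (can_inj (_ : cancel (fun b : bool => b%:R : 'F_2) (fun c => c != 0))).
    by case.
  rewrite -natr_odd_F2 -F2_natr exprD cP mulr_suml linear_sum natr_sum /=.
  rewrite (reindex_inj rev_ord_inj) /=; apply: eq_bigr => j _.
  rewrite -scalerAl linearZ /= -exprD nth_mkseq // -mulnb natrM.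
  rewrite -!F2_natr; congr (_ * phi (y ^+ _)).
  by have := ltn_ord j; lia.
rewrite nth_mkseq; last by have := ltn_ord i; lia.
have -> : (m + n - i.+1 = m + (n - i.+1))%N by have := ltn_ord i; lia.
by rewrite /r phiX //; case: (i \in A).
Qed.

End FiniteField.

(** * Correctness and running time *)

Section Improvement.
Variables (beta n k : nat) (G : sgraph 'I_n) (S S' : {set 'I_n}).
Hypotheses (sep : Defs.separable G beta) (cover' : vertex_cover G S').
Hypotheses (close : dist S S' <= k) (smaller : #|S'| < #|S|).

(** A vertex of degree above [beta] can only lie in [V1], and so do its neighbours of high degree;
    hence degrees can replace the unknown partition. *)
Lemma nbr_lowdeg_le i :
  #|neighbors G i :&: (if i \in lowdeg beta G then setT else ~: lowdeg beta G)| <= beta.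
Proof.
have [V1 [V2 [V12 _ V1P V2P]]] := sep.
have V1_high j : j \notin lowdeg beta G -> j \in V1.
  move=> j_high; have : j \in V1 :|: V2 by rewrite V12 inE.
  by rewrite inE => /orP[//|/V2P low_j]; rewrite inE low_j in j_high.
case: ifP => [|/negbT i_high]; first by rewrite inE setIT.
apply: leq_trans (V1P i (V1_high i i_high)); apply/subset_leq_card/subsetP => j.
by rewrite !inE => /andP[->] j_high; apply: V1_high; rewrite inE.
Qed.

(** Any [#|S' :\: S| + 1] vertices of [S :\: S'] will do. The two differences have at most [k]
    elements together and the second is larger, which bounds this number by [uphalf k]. *)
Lemma small_improvement : exists A : {set 'I_n},
  [/\ A \subset S :\: S', #|S' :\: S| < #|A| & #|A| <= uphalf k].
Proof.
have cS := cardsID S' S; have cS' := cardsID S S'; rewrite setIC in cS'.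
have cU := cardsUI S S'.
have lt_D : #|S' :\: S| < #|S :\: S'| by lia.
have [s [s_uniq size_s sub_s]] := card_geqP lt_D.
exists [set x in s]; have -> : #|[set x in s]| = #|S' :\: S|.+1.
  by rewrite cardsE -size_s; apply/card_uniqP.
split=> //; first by apply/subsetP => x; rewrite inE => /sub_s.
move: close; rewrite /dist; lia.
Qed.

Lemma search_improvement (m := beta.+1 * uphalf k + lg n) :
  search beta (adj_rows G) (bitv S) m [::] [::].
Proof.
have [A [subA defA leA]] := small_improvement.
have inA i : i \in A -> (i \in S) * (i \in S' = false).
  by move=> /(subsetP subA); rewrite inE => /andP[/negbTE-> ->].
pose mask i := if i \in lowdeg beta G then setT else ~: lowdeg beta G.
(* [R] collects the vertices that would delete a member of [A] if they were green. *)
pose R := \bigcup_(i in A) (neighbors G i :&: mask i).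
have indep i j : i \in A -> G i j -> j \in S'.
  by move=> /inA iA /cover'; rewrite iA.
have cardR : #|R| <= #|A| * beta.
  rewrite -sum_nat_const; apply: (@leq_trans (\sum_(i in A) #|neighbors G i :&: mask i|)).
    rewrite /R; elim/big_rec2: _ => [|i l X _ le_l]; first by rewrite cards0.
    by rewrite (leq_trans (leq_card_setU _ _)) // leq_add2l.
  by apply: leq_sum => i _; apply: nbr_lowdeg_le.
have AR i : i \in A -> i \notin R.
  move=> iA; apply/negP => /bigcupP[j jA]; rewrite !inE => /andP[Gji _].
  by have := indep j i jA Gji; rewrite inA.
(* [A] and [R] have at most [(beta + 1) * uphalf k] elements together, and [2 ^ lg n] exceeds
   [n]. *)
have lt_m : n * 2 ^ #|A :|: R| < 2 ^ m.
  apply: (@leq_ltn_trans (n * 2 ^ (beta.+1 * uphalf k))).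
    rewrite leq_mul2l leq_exp2l //; apply/orP; right.
    rewrite (leq_trans (leq_card_setU _ _)) // (leq_trans (leq_add (leqnn _) cardR)) //.
    by rewrite -mulnS mulnC leq_mul2l leA orbT.
  rewrite /m expnD [n * _]mulnC ltn_mul2l expn_gt0 /= /lg.
  by case: eqP => [->|/eqP]; rewrite // -lt0n => n_gt0; apply: trunc_log_ltn.
(* The bit is 1 on [R] and 0 on [A]; the remaining vertices may get any colour. *)
have [f [w [size_f size_w colour]]] := lfsr_universal R lt_m.
have := @search_complete beta (adj_rows G) (bitv S) (rev f) (rev w) [::] [::].
rewrite !catrevE !cats0 !revK !size_rev size_f size_w; apply=> //.
apply: (@test_complete _ _ _ _ _ _ A); last first.
  apply: leq_ltn_trans defA; apply/subset_leq_card/subsetP => j.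
  rewrite !inE => /andP[-> /bigcupP[i iA]]; rewrite inE; exact: indep.
apply/subsetP => i iA; rewrite inE !inE inA //= colour ?inE ?iA // AR //=.
apply/pred0P => j /=; apply/negP; rewrite inE => /andP[Gij].
move=> mj; have {mj} [jS jbit jmask] : [/\ j \in S, ~~ nth false (gen n w f) j & j \in mask i].
  move: mj; rewrite /mask [i \in lowdeg _ _]inE; case: ifP => _; rewrite !inE.
    by case/andP.
  by case/and3P.
have jR : j \in R by apply/bigcupP; exists i => //; rewrite !inE Gij.
by rewrite colour ?jR // inE jR orbT in jbit.
Qed.

End Improvement.

(** * Correctness on encoded instances, and the arithmetic of the bounds *)

Lemma set_treeE n (A : {set 'I_n}) : set_tree A = bits (bitv A).
Proof. by rewrite /bits /bitv -map_comp. Qed.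

Lemma pls_vc_encodeE x :
  pls_vc_encode x = Node (list_tree (map bits (adj_rows (graph x))))
    (Node (bits (bitv (Defs.cover x))) (Node (nat_tree (radius x)) Leaf)).
Proof.
rewrite /pls_vc_encode /graph_tree /adj_rows -map_comp -set_treeE.
by congr (Node (list_tree _) _); apply: eq_map => i; rewrite set_treeE.
Qed.

Lemma prog_correct beta (x : pls_vc_instance) (n := nverts x) (k := radius x)
    (m := beta.+1 * uphalf k + lg n) :
  valid (x : instance (pls_vc beta)) ->
  exists v t, [/\ runs (prog beta) (pls_vc_encode x) v t, pls_vc_answer x v
    & t <= 4 ^ m * (3000 * beta.+1 * (n + m + 2) ^ 4 + 400) + (10 + 2 * beta.+1) * k.+1
           + 100 * n.+1 + 100].
Proof.
rewrite {}/m {}/n {}/k; case: x => n G S k /= [coverS _ sep].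
have size_rows : size (adj_rows G) = size (bitv S).
  by rewrite size_bitv size_map size_enum_ord.
have size_row : all (fun r => size r == size (bitv S)) (adj_rows G).
  by rewrite all_map; apply/allP => i _ /=; rewrite !size_bitv.
have [t run_t le_t] := fev_main beta size_rows size_row k.
rewrite size_bitv in run_t le_t.
exists (enc_entry (search beta (adj_rows G) (bitv S) (beta.+1 * uphalf k + lg n) [::] [::])), t.
split=> //; first by rewrite pls_vc_encodeE.
case E: (search _ _ _ _ _ _) => [T|].
  have [f [w testT]] := search_sound E.
  have [S'' [-> cover'' lt_S]] := test_sound coverS testT.
  by right; exists S''; rewrite set_treeE.
left; split=> // -[S' [cover' close lt_S]].
by have := search_improvement sep cover' close lt_S; cbv zeta; rewrite E.
Qed.

(** Although there are [4 ^ m] sequences, [2 * uphalf k <= k + 1] leaves only [2 ^ ((beta + 1) * k)]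
    up to a constant and the square of [2 ^ lg n], which is linear in [n]. *)
Lemma time_estimate a b d e beta n k (m := beta.+1 * uphalf k + lg n) :
  4 ^ m * (a * beta.+1 * (n + m + 2) ^ 4 + b) + d * k.+1 + e * n.+1 + e
  <= (2 ^ beta.+1 * 4 * ((a + b) * beta.+1 * (beta + 5) ^ 4) + d + e + e)
     * (2 ^ (beta.+1 * k) * k.+1 ^ 4 * n.+1 ^ 6).
Proof.
have lg_le : 2 ^ lg n <= 2 * n.+1.
  rewrite /lg; case: eqP => // /eqP; rewrite -lt0n => n_gt0.
  by rewrite expnS leq_mul2l /= (leq_trans (trunc_logP _ n_gt0)).
have lg_le' : lg n <= 2 * n.+1 by apply: leq_trans lg_le; apply/ltnW/ltn_expl.
set Y := 2 ^ (beta.+1 * k) * k.+1 ^ 4 * n.+1 ^ 6.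
(* In [beta + 5], the part [beta + 1] covers the multiple of [uphalf k], and 4 covers
   [n + lg n + 2]. *)
have le_m : n + m + 2 <= (beta + 5) * (k.+1 * n.+1).
  have le_K : k.+1 <= k.+1 * n.+1 by rewrite leq_pmulr.
  have le_N : n.+1 <= k.+1 * n.+1 by rewrite leq_pmull.
  have le_b : beta.+1 * uphalf k <= beta.+1 * (k.+1 * n.+1).
    by rewrite leq_mul2l (leq_trans _ le_K) ?orbT //; lia.
  rewrite /m; move: (k.+1 * n.+1) le_K le_N le_b => KN le_K le_N le_b.
  by rewrite -[_ + 5](addSnnS beta 4) mulnDl; lia.
have le_4m : 4 ^ m <= 2 ^ beta.+1 * 4 * (2 ^ (beta.+1 * k) * n.+1 ^ 2).
  rewrite -[4]/(2 ^ 2) -expnM /m mulnDr expnD.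
  have -> : 2 ^ beta.+1 * 2 ^ 2 * (2 ^ (beta.+1 * k) * n.+1 ^ 2) =
            2 ^ (beta.+1 * k.+1) * (2 * n.+1) ^ 2.
    by rewrite mulnS expnD expnMn; lia.
  apply: leq_mul; last by rewrite mulnC expnM leq_exp2r.
  by rewrite leq_exp2l // mulnCA leq_mul2l /=; lia.
have le_poly : a * beta.+1 * (n + m + 2) ^ 4 + b <=
    (a + b) * beta.+1 * (beta + 5) ^ 4 * (k.+1 ^ 4 * n.+1 ^ 4).
  have := leq_exp2r (n + m + 2) ((beta + 5) * (k.+1 * n.+1)) (isT : 0 < 4).
  rewrite le_m !expnMn => le4; rewrite -[leqRHS]mulnA.
  have : 0 < (beta + 5) ^ 4 * (k.+1 ^ 4 * n.+1 ^ 4).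
    by rewrite muln_gt0 expn_gt0 muln_gt0 !expn_gt0 addnS.
  move: ((n + m + 2) ^ 4) (_ * _) le4 => X Z le_XZ Z_gt0.
  rewrite !mulnDl; apply: leq_add; first by rewrite leq_mul2l le_XZ orbT.
  by rewrite -mulnA leq_pmulr // muln_gt0.
have pos2 : 0 < 2 ^ (beta.+1 * k) by rewrite expn_gt0.
have le_main : 4 ^ m * (a * beta.+1 * (n + m + 2) ^ 4 + b) <=
    2 ^ beta.+1 * 4 * ((a + b) * beta.+1 * (beta + 5) ^ 4) * Y.
  have acE P Q x1 x2 y1 y2 : P * (x1 * y1) * (Q * (x2 * y2)) = P * Q * (x1 * x2 * (y1 * y2)).
    by rewrite mulnACA [x1 * y1 * _]mulnACA.
  have e6 : n.+1 ^ 6 = n.+1 ^ 2 * n.+1 ^ 4 by rewrite -expnD.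
  by apply: leq_trans (leq_mul le_4m le_poly) _; rewrite acE /Y e6 leqnn.
have [posk posn] : 0 < k.+1 ^ 4 /\ 0 < n.+1 ^ 6 by rewrite !expn_gt0.
have le_k : k.+1 <= Y.
  apply: (@leq_trans (k.+1 ^ 4)); first by rewrite -{1}[k.+1]expn1 leq_pexp2l.
  by rewrite /Y mulnAC leq_pmull // muln_gt0 pos2.
have le_n : n.+1 <= Y.
  apply: (@leq_trans (n.+1 ^ 6)); first by rewrite -{1}[n.+1]expn1 leq_pexp2l.
  by rewrite /Y leq_pmull // muln_gt0 pos2.
rewrite 2!(mulnDl _ e Y) (mulnDl _ d Y); apply: leq_add; last first.
  by rewrite leq_pmulr // (leq_trans _ le_n).
by apply: leq_add; [apply: leq_add => //|]; rewrite leq_mul2l ?le_k ?le_n orbT.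
Qed.

(** Function 1 doubles a unary number; function 0 recurses on [k], starts from [C] and doubles [E]
    times per unit. *)
Lemma computable_const_exp C E : computable (fun k => C * 2 ^ (E * k)).
Proof.
pose p : program := [:: Case (Var 0) (add_expr C Lf) (iter E (Call 1) (Call 0 (Var 1)));
                       Case (Var 0) Lf (Nd Lf (Nd Lf (Call 1 (Var 1))))].
exists p => k.
have add s c : exists T, ev p s (add_expr c Lf) (nat_tree c) T.
  elim: c => [|c [T IH]]; first by exists 1; apply: ev_lf.
  by eexists; apply: ev_nd (ev_lf _ _) IH.
have double c : exists T, ev p [:: nat_tree c] (nth Lf p 1) (nat_tree (2 * c)) T.
  elim: c => [|c [T IH]]; first by eexists; apply: ev_case_leaf (ev_lf _ _); apply: ev_var.
  eexists; rewrite mulnS; apply: ev_case_node; first exact: ev_var.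
  apply: ev_nd (ev_lf _ _) _; apply: ev_nd (ev_lf _ _) _.
  by apply: ev_call IH; apply: ev_var.
suff [T [t run_t _]] : exists T, ev p [:: nat_tree k] (nth Lf p 0) (nat_tree (C * 2 ^ (E * k))) T.
  by exists t.
elim: k => [|k [T IH]].
  have [T addC] := add [:: Leaf] C.
  by rewrite muln0 muln1; eexists; apply: ev_case_leaf addC; apply: ev_var.
have iterP j : exists T', ev p [:: Leaf; nat_tree k; nat_tree k.+1]
    (iter j (Call 1) (Call 0 (Var 1))) (nat_tree (2 ^ j * (C * 2 ^ (E * k)))) T'.
  elim: j => [|j [T' IHj]].
    by rewrite mul1n; eexists; apply: ev_call IH; apply: ev_var.
  have [T'' dbl] := double (2 ^ j * (C * 2 ^ (E * k))).
  by rewrite expnS -mulnA; eexists; apply: ev_call IHj dbl.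
have [T' iterT] := iterP E.
by rewrite mulnS expnD mulnCA; eexists; apply: ev_case_node iterT; apply: ev_var.
Qed.

Lemma tree_size_encode x : (nverts x).+1 <= tree_size (pls_vc_encode x).
Proof.
have size_list l : size l < tree_size (list_tree l).
  by elim: l => //= u l IH; rewrite ltnS (leq_trans IH) // leq_addl.
have := size_list [seq set_tree (neighbors (graph x) i) | i <- enum 'I_(nverts x)].
rewrite size_map size_enum_ord => lt_n; apply: leq_trans lt_n _.
exact: leqW (leq_addr _ _).
Qed.

Lemma prog_time beta : exists C, forall x : pls_vc_instance,
  valid (x : instance (pls_vc beta)) -> exists v t,
  [/\ runs (prog beta) (pls_vc_encode x) v t, pls_vc_answer x v
    & t <= C * (2 ^ (beta.+1 * radius x) * (radius x).+1 ^ 4 * (nverts x).+1 ^ 6)].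
Proof.
(* The constant is left open and read off from [time_estimate]. *)
eexists => x /prog_correct[v [t [run_t ans le_t]]]; exists v, t; split=> //.
exact: leq_trans le_t (time_estimate _ _ _ _ _ _ _).
Qed.

Theorem theorem4 (beta : nat) :
  fixed_parameter_tractable (pls_vc beta) /\
  exists c : nat,
    @solvable_in_time (pls_vc beta)
      (fun x : pls_vc_instance =>
         time_bound c (radius x + beta * radius x) (nverts x)).
Proof.
have [C progP] := prog_time beta; split.
  (* [(k + 1) ^ 4] is at most [2 ^ (4 * k)], and [n + 1] is at most the size of the encoding. *)
  exists (fun k => C * 2 ^ ((beta.+1 + 4) * k)), 6.
  split; first exact: computable_const_exp.
  exists (prog beta) => x /progP[v [t [run_t ans le_t]]].
  exists v, t; split=> //; apply: leq_trans le_t _.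
  rewrite mulnA; apply: leq_mul; last by rewrite leq_exp2r // tree_size_encode.
  rewrite leq_mul2l mulnDl expnD; apply/orP; right; apply: leq_mul => //.
  by rewrite [4 * _]mulnC expnM leq_exp2r // ltn_expl.
(* 16 comes from [(k + 1) ^ 4 <= (2 * q) ^ 4], and 6 is the exponent of [n + 1]. *)
pose c := 16 * C + 6; exists c; exists (prog beta) => x xP.
have k_gt0 : 0 < radius x by case: xP.
have [v [t [run_t ans le_t]]] := progP x xP; exists v, t; split=> //.
apply: leq_trans le_t _.
rewrite /time_bound -mulSn; set q := beta.+1 * _; set k := radius x in k_gt0 q *.
have le_kq : k <= q by rewrite leq_pmull.
have q_gt0 : 0 < q by apply: leq_trans le_kq.
(* For [q > 1] the exponent [c * trunc_log 2 q] is at least 4; for [q = 1] the logarithm is 0 and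
   the factor 16 alone suffices. *)
have le_poly : k.+1 ^ 4 <= 16 * q ^ (c * trunc_log 2 q).
  apply: (@leq_trans ((2 * q) ^ 4)); first by rewrite leq_exp2r // mul2n; lia.
  rewrite expnMn leq_mul2l /=; case: (ltngtP q 1) => [|q_gt1|->]; [by lia| |by rewrite !exp1n].
  rewrite leq_exp2l // -[4]muln1; apply: leq_mul; first by rewrite /c; lia.
  by rewrite trunc_log_gt0.
have le_n : (nverts x).+1 ^ 6 <= (nverts x).+1 ^ c.
  by rewrite leq_pexp2l // /c leq_addl.
apply: (@leq_trans (C * (2 ^ q * (16 * q ^ (c * trunc_log 2 q)) * (nverts x).+1 ^ c))).
  by apply: leq_mul => //; apply: leq_mul => //; apply: leq_mul.
rewrite (mulnCA _ 16) -(mulnA 16) mulnCA mulnA.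
by apply: leq_mul => //; rewrite /c leq_addr.
Qed.
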